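(* Let $n \ge 2$ be an integer and $r>0$. Let $\lambda_1^\alpha$ be the first eigenvalue of $$-\frac{d^2}{dt^2}u + \frac{n-1}{4}\left(n-1+\frac{\alpha}{\sinh^2 t}\right)u = \lambda u$$ with Dirichlet boundary conditions at $0$ and $r$. For $\alpha \ge 0$, we have $$\lambda_1^\alpha < \frac{(n-1)^2}{4} + \frac{\pi^2}{r^2} + \frac{(n-1)\alpha}{12\, r^3}\pi^4.$$ In particular, the first two eigenvalues $\lambda_1,\lambda_2$ of the Laplacian $-\Delta$ with Dirichlet boundary conditions on the geodesic ball of radius $r$ in $\mathbb{H}^n$ satisfy $$\lambda_1 < \frac{(n-1)^2}{4} + \frac{\pi^2}{r^2} + \frac{(n-1)(n-3)}{12\, r^3}\pi^4 \quad \text{for } n \ge 3,$$ $$\lambda_2 < \frac{(n-1)^2}{4} + \frac{\pi^2}{r^2} + \frac{(n-1)(n+1)}{12\, r^3}\pi^4 \quad \text{for } n \ge 2.$$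
   Context: $\mathbb{H}^n$ is the $n$-dimensional hyperbolic space of constant sectional curvature $-1$. The eigenvalue problem defining $\lambda_1^\alpha$ is posed on the interval $(0,r)$ with $u(0)=u(r)=0$. Eigenvalues of the Laplacian are listed in increasing order, counted with multiplicity.
   Formalization: The strict bounds fail by equality when α = 0 and, for λ₁ of the ball, when n = 3; there ≤ is proved instead of <, while < is kept for every α > 0, for λ₁ with every n > 3, and for λ₂ with every n ≥ 2. *)

(* Defs.v *)
From HB Require Import structures.
From mathcomp Require Import all_boot all_order all_algebra.
From mathcomp Require Import all_classical all_reals all_analysis.
Set Implicit Arguments.
Unset Strict Implicit.
Unset Printing Implicit Defensive.
Import Order.TTheory GRing.Theory Num.Theory.
Import numFieldNormedType.Exports.
Local Open Scope classical_set_scope.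
Local Open Scope ring_scope.

Definition sinh (R : realType) (x : R) : R := (expR x - expR (- x)) / 2.

Definition acosh (R : realType) (x : R) : R := ln (x + Num.sqrt (x ^+ 2 - 1)).

Definition potential (R : realType) (n : nat) (alpha t : R) : R :=
  (n%:R - 1) / 4 * (n%:R - 1 + alpha / sinh t ^+ 2).

(* Classical eigenvalues: for alpha > 0 the potential blows up at 0, and one
   of the two exponents of the equation there is negative; continuity on
   [0, r] together with u 0 = 0 selects the other one. *)
Definition interval_eigenvalue (R : realType) (n : nat) (r alpha lambda : R)
    : Prop :=
  exists u : R -> R,
    [/\ {within `[0, r], continuous u},
        u 0 = 0, u r = 0,
        exists2 t, t \in `]0, r[ & u t != 0 &
        forall t, t \in `]0, r[ ->
          [/\ derivable u t 1, derivable (derive1 u) t 1 &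
              - derive1n 2 u t + potential n alpha t * u t = lambda * u t] ].

Definition first_interval_eigenvalue (R : realType) (n : nat)
    (r alpha lambda : R) : Prop :=
  interval_eigenvalue n r alpha lambda /\
  forall mu, interval_eigenvalue n r alpha mu -> lambda <= mu.

Definition partial (R : realType) (d : nat) (i : 'I_d) (u : 'rV[R]_d -> R)
    (x : 'rV[R]_d) : R := 'D_(delta_mx 0 i) (u : 'rV[R]_d -> R^o) x.

Definition C2_on (R : realType) (d : nat) (Omega : set 'rV[R]_d)
    (u : 'rV[R]_d -> R) : Prop :=
  forall x, Omega x -> {for x, continuous u} /\
    forall i : 'I_d,
      [/\ derivable (u : 'rV[R]_d -> R^o) x (delta_mx 0 i),
          {for x, continuous (partial i u)} &
          forall j : 'I_d,
            derivable (partial i u : 'rV[R]_d -> R^o) x (delta_mx 0 j) /\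
            {for x, continuous (partial j (partial i u))} ].

(* [g x] is the Gram matrix of the metric at [x] in the coordinate frame. *)
Definition laplace_beltrami (R : realType) (d : nat)
    (g : 'rV[R]_d -> 'M[R]_d) (u : 'rV[R]_d -> R) (x : 'rV[R]_d) : R :=
  (Num.sqrt (\det (g x)))^-1 *
  \sum_(i < d) partial i (fun z => Num.sqrt (\det (g z)) *
    \sum_(j < d) invmx (g z) i j * partial j u z) x.

(* Functions are total; only their values on [closure Omega] matter, whence
   the relative notion of freeness [free_on] below. *)
Definition dirichlet_eigenspace (R : realType) (d : nat)
    (g : 'rV[R]_d -> 'M[R]_d) (Omega : set 'rV[R]_d) (lambda : R)
    (u : 'rV[R]_d -> R) : Prop :=
  [/\ {within closure Omega, continuous u},
      C2_on Omega u,
      forall x, (closure Omega `\` Omega) x -> u x = 0 &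
      forall x, Omega x -> - laplace_beltrami g u x = lambda * u x].

Definition free_on (R : realType) (T : Type) (A : set T) (k : nat)
    (f : 'I_k -> T -> R) : Prop :=
  forall c : 'I_k -> R,
    (forall x, A x -> \sum_(i < k) c i * f i x = 0) -> forall i, c i = 0.

(* [lam 0, lam 1, ...] lists the eigenvalues in increasing order with
   multiplicity: for every real [mu], the number of indices [i] such that
   [lam i = mu] is the dimension of the eigenspace of [mu]. *)
Definition dirichlet_spectrum (R : realType) (d : nat)
    (g : 'rV[R]_d -> 'M[R]_d) (Omega : set 'rV[R]_d) (lam : nat -> R) : Prop :=
  nondecreasing_seq lam /\
  forall (mu : R) (k : nat),
    (exists f : 'I_k -> 'rV[R]_d -> R,
      (forall i, dirichlet_eigenspace g Omega mu (f i)) /\ free_on Omega f) <->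
    (exists s : seq nat,
      [/\ uniq s, size s = k & forall i, i \in s -> lam i = mu]).

(* Hyperbolic space H^(m+1) of curvature -1 is taken in the upper half-space
   model: the points are the x with 0 < height x. *)
Definition height (R : realType) (m : nat) (x : 'rV[R]_m.+1) : R := x 0 ord_max.

Definition hyp_metric (R : realType) (m : nat) (x : 'rV[R]_m.+1)
    : 'M[R]_m.+1 := (height x ^- 2)%:M.

Definition hyp_dist (R : realType) (m : nat) (x y : 'rV[R]_m.+1) : R :=
  acosh (1 + (\sum_(i < m.+1) (x 0 i - y 0 i) ^+ 2) /
             (2 * height x * height y)).

Definition geodesic_ball (R : realType) (m : nat) (p : 'rV[R]_m.+1) (r : R)
    : set 'rV[R]_m.+1 :=
  [set x | 0 < height x /\ hyp_dist p x < r].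

(* Main.v *)
(* Put s(s-1) = (n-1) alpha/4. The solution of the interval equation that is
   regular at 0 is sinh^s t F(cosh t - 1), where F is a radial eigenfunction of
   the Laplacian in the fictitious dimension 2s+1; it is the sum of a power
   series in tanh^2(t/2). Both bounds follow from the mere existence of an
   eigenvalue below the bound, which is obtained by shooting: starting from
   F = 1 for the eigenvalue 0, one increases the eigenvalue until F ceases to be
   positive on [0, r]. This happens below the bound, because Picone's identity
   with the test function sin(pi t/r), sin x <= x and
   int_0^r t^2/sinh^2 t dt < sum_k 1/k^2 = pi^2/6 exclude positivity beyond it.
   On the ball, F(cosh d - 1) with 2s+1 = n is an eigenfunction (alpha = n-3),
   and so is F(cosh d - 1) times a hyperboloid coordinate vanishing at the center
   when 2s+1 = n+2 (alpha = n+1). Two independent such coordinates put two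
   eigenvalues, with multiplicity, below the bound, whence the one on the
   second eigenvalue. *)
Require Import Defs.
From HB Require Import structures.
From mathcomp Require Import all_boot all_order all_algebra.
From mathcomp Require Import all_classical all_reals all_analysis.
From mathcomp Require Import zify ring lra.
Set Implicit Arguments.
Unset Strict Implicit.
Unset Printing Implicit Defensive.
Import Order.TTheory GRing.Theory Num.Theory.
Import numFieldNormedType.Exports.
Local Open Scope classical_set_scope.
Local Open Scope ring_scope.

(** * Power series with radius of convergence at least 1 *)

(** No integral is formed: each integral inequality is stated as monotonicity of an explicit
    primitive, so that only derivatives and the behaviour at the singular endpoint 0 matter. The
    constant comes from a Rayleigh quotient. With c = s(s-1) and k = pi/r, the test function gives
    k^2 + (2/r) c int_0^r sin^2(kt)/sinh^2 t dt, and sin(kt) <= kt with the bound pi^2/6 turns this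
    into k^2 + c pi^4/(3 r^3); since c = (n-1) alpha/4, the factor 1/3 becomes 1/12. For c = 0 the
    sine itself is the eigenfunction and the bound is attained, which is why alpha = 0, and n = 3 on
    the ball, carry [<=] instead of [<]. The radial equation is singular at 0. What the shooting
    needs (value 1 at 0, Lipschitz dependence on the eigenvalue, simplicity of the zeros) is
    therefore taken from the power series and from an energy, not from a regular Cauchy problem. *)

Definition unit_radius (R : realType) (c : nat -> R) : Prop :=
  forall rho : R, 0 < rho < 1 -> exists C, forall k, `|c k| * rho ^+ k <= C.

Definition psum (R : realType) (c : nat -> R) (x : R) : R := limn (pseries c x).

(** Multiplication of the series by its variable. In recurrences it also supplies the previous
    coefficient, with value 0 before the first one. *)
Definition shift_coef (R : realType) (c : nat -> R) (k : nat) : R :=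
  if k is k'.+1 then c k' else 0.

Section PowerSeries.
Variable R : realType.
Implicit Types (c d : nat -> R) (x : R).

Lemma eventually_nonincr_bounded c (k0 : nat) :
  (forall k, (k0 <= k)%N -> c k.+1 <= c k) -> exists C, forall k, c k <= C.
Proof.
move=> h; exists (\sum_(0 <= j < k0.+1) `|c j|) => k.
have bnd j : (j <= k0)%N -> c j <= \sum_(0 <= j < k0.+1) `|c j|.
  move=> jk; rewrite big_mkord (bigD1 (Ordinal (jk : (j < k0.+1)%N)))//=.
  by rewrite (le_trans (ler_norm _))// lerDl sumr_ge0.
have [/bnd//|/ltnW kk0] := leqP k k0.
rewrite (le_trans _ (bnd k0 (leqnn _)))//.
rewrite -(subnK kk0); elim: (k - k0)%N => [|i IH]; first by rewrite add0n.
by rewrite addSn (le_trans (h _ _))// leq_addl.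
Qed.

Lemma unit_radius_half x : `|x| < 1 -> exists2 r : R, 0 < r < 1 & `|x| < r.
Proof.
move=> x1; have x0 := normr_ge0 x.
by exists ((`|x| + 1) / 2); lra.
Qed.

(** Abel's lemma: terms bounded at a radius r > |x| are dominated at x by a geometric series of
    ratio |x|/r. *)
Lemma unit_radius_cvg_norm c x : unit_radius c -> `|x| < 1 ->
  cvgn (series (fun k => `|c k| * `|x| ^+ k)).
Proof.
move=> hc x1; have [r r01 xr] := unit_radius_half x1.
have [r0 r1] := andP r01.
have [C hC] := hc r r01.
apply: (@series_le_cvg _ _ (geometric C (`|x| / r))) => [k|k|k|].
- by rewrite mulr_ge0// exprn_ge0.
- rewrite /geometric/= mulr_ge0//; last by rewrite exprn_ge0// divr_ge0// ltW.
  exact: le_trans (mulr_ge0 (normr_ge0 _) (exprn_ge0 _ (ltW r0))) (hC 0%N).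
- rewrite /geometric/= expr_div_n mulrA ler_pdivlMr ?exprn_gt0//.
  by rewrite mulrAC ler_wpM2r// exprn_ge0.
- apply: is_cvg_geometric_series.
  by rewrite ger0_norm ?divr_ge0 ?(ltW r0)// ltr_pdivrMr// mul1r.
Qed.

Lemma unit_radius_cvg c x : unit_radius c -> `|x| < 1 -> cvgn (pseries c x).
Proof.
move=> hc x1; apply: normed_cvg; rewrite /normed_series_of /=.
under eq_fun do rewrite normrM normrX.
exact: unit_radius_cvg_norm.
Qed.

Lemma unit_radiusD c d : unit_radius c -> unit_radius d ->
  unit_radius (fun k => c k + d k).
Proof.
move=> hc hd r r01; have [C hC] := hc r r01; have [D hD] := hd r r01.
exists (C + D) => k; rewrite (le_trans _ (lerD (hC k) (hD k)))// -mulrDl.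
by rewrite ler_wpM2r ?ler_normD// exprn_ge0//; case/andP: r01 => /ltW.
Qed.

Lemma unit_radiusZ a c : unit_radius c -> unit_radius (fun k => a * c k).
Proof.
move=> hc r r01; have [C hC] := hc r r01; exists (`|a| * C) => k.
by rewrite normrM -mulrA ler_wpM2l.
Qed.

Lemma unit_radius_shift c : unit_radius c -> unit_radius (shift_coef c).
Proof.
move=> hc r r01; have [C hC] := hc r r01; have [r0 r1] := andP r01.
have C0 : 0 <= C.
  by rewrite (le_trans _ (hC 0%N))// mulr_ge0 // exprn_ge0// ltW.
exists (r * C) => -[|k] /=; first by rewrite normr0 mul0r mulr_ge0// ltW.
by rewrite exprS mulrCA ler_wpM2l// ltW.
Qed.

Lemma unit_radius_le c d : (forall k, `|c k| <= d k) -> unit_radius d ->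
  unit_radius c.
Proof.
move=> cd hd r r01; have [C hC] := hd r r01; exists C => k.
rewrite (le_trans _ (hC k))// ler_wpM2r ?(le_trans (cd k))// ?ler_norm//.
by rewrite exprn_ge0//; case/andP: r01 => /ltW.
Qed.

(** Passing from r to a larger r' < 1 costs a factor (r/r')^k, which absorbs the k+1 produced by
    differentiation. *)
Lemma unit_radius_diffs c : unit_radius c -> unit_radius (pseries_diffs c).
Proof.
move=> hc r /andP[r0 r1].
have [r' /andP[r'0 r'1] rr'] : exists2 r' : R, 0 < r' < 1 & r < r'.
  by exists ((r + 1) / 2); lra.
have [C hC] := hc r' (introT andP (conj r'0 r'1)).
have C0 : 0 <= C.
  by rewrite (le_trans _ (hC 0%N))// mulr_ge0 // exprn_ge0// ltW.
pose q := r / r'.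
have q0 : 0 < q by rewrite divr_gt0.
have q1 : q < 1 by rewrite ltr_pdivrMr// mul1r.
have [D hD] : exists D, forall k : nat, k.+1%:R * q ^+ k <= D.
  (* As (k+2) q <= k+1 once k+2 >= 1/(1-q), the sequence decreases from [k0] on. *)
  pose k0 := Num.Def.archi_bound (1 - q)^-1.
  apply: (@eventually_nonincr_bounded _ k0) => k kk.
  rewrite exprS mulrA ler_wpM2r ?exprn_ge0 ?(ltW q0)//.
  have h : (1 - q)^-1 < k.+2%:R :> R.
    have h1 : (1 - q)^-1 < k0%:R by rewrite archi_boundP// invr_ge0; lra.
    by rewrite (lt_le_trans h1)// ler_nat (leq_trans kk)// -addn2 leq_addr.
  have q1' : 0 < 1 - q by rewrite subr_gt0.
  have h' : 1 <= (1 - q) * k.+2%:R by rewrite -ler_pdivrMl// mulr1 ltW.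
  move: h'; rewrite -[k.+2%:R]natr1; move: (k.+1%:R : R) => y; lra.
have D0 : 0 <= D by rewrite (le_trans _ (hD 0%N))// expr0 mulr1.
exists (D * (C / r')) => k.
rewrite /pseries_diffs normrM normr_nat.
have -> : r = q * r' by rewrite /q divfK// gt_eqF.
have -> : k.+1%:R * `|c k.+1| * (q * r') ^+ k =
    (k.+1%:R * q ^+ k) * (`|c k.+1| * r' ^+ k.+1 / r').
  by rewrite exprMn exprS; field; rewrite gt_eqF.
apply: ler_pM => //.
- by rewrite mulr_ge0// exprn_ge0// ltW.
- by rewrite !mulr_ge0 ?exprn_ge0 ?invr_ge0// ltW.
- by rewrite ler_wpM2r// invr_ge0 ltW.
Qed.

Lemma psumD c d x : unit_radius c -> unit_radius d -> `|x| < 1 ->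
  psum (fun k => c k + d k) x = psum c x + psum d x.
Proof.
move=> hc hd x1; rewrite /psum -limD; [|exact: unit_radius_cvg..].
congr (limn _); apply/funext => n; rewrite /pseries /series/= fctE -big_split/=.
by apply: eq_bigr => i _; rewrite mulrDl.
Qed.

Lemma psumZ a c x : unit_radius c -> `|x| < 1 ->
  psum (fun k => a * c k) x = a * psum c x.
Proof.
move=> hc x1; apply: cvg_lim => //.
rewrite (_ : pseries _ _ = (fun n => a * pseries c x n)).
  by apply: cvgM; [exact: cvg_cst|exact: unit_radius_cvg].
apply/funext => n; rewrite /pseries /series/= mulr_sumr.
by apply: eq_bigr => i _; rewrite mulrA.
Qed.

Lemma psum0 c x : (forall k, c k = 0) -> psum c x = 0.
Proof.
move=> c0; rewrite /psum (_ : pseries c x = cst 0) ?lim_cst//.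
by apply/funext => n; rewrite /pseries/series/= big1// => i _; rewrite c0 mul0r.
Qed.

Lemma psum_shift c x : unit_radius c -> `|x| < 1 ->
  psum (shift_coef c) x = x * psum c x.
Proof.
move=> hc x1; apply: cvg_lim => //; rewrite -cvg_shiftS.
have -> : (fun n => pseries (shift_coef c) x n.+1) = (fun n => x * pseries c x n).
  apply/funext => n; rewrite /pseries/series/= big_nat_recl//= mul0r add0r.
  by rewrite mulr_sumr; apply: eq_bigr => i _; rewrite exprS mulrCA.
by apply: cvgM; [exact: cvg_cst|exact: unit_radius_cvg].
Qed.

Lemma psum_at0 c : psum c 0 = c 0%N.
Proof.
rewrite /psum; apply: cvg_lim => //; rewrite -cvg_shiftS.
rewrite (_ : (fun n => _) = cst (c 0%N)); first exact: cvg_cst.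
apply/funext => n; rewrite /pseries/series/= big_nat_recl//= expr0 mulr1.
by rewrite big1 ?addr0// => i _; rewrite exprS mul0r mulr0.
Qed.

Lemma is_derive_psum c x : unit_radius c -> `|x| < 1 ->
  is_derive x 1 (psum c) (psum (pseries_diffs c) x).
Proof.
move=> hc x1; have [r /andP[r0 r1] xr] := unit_radius_half x1.
have rr : `|r| < 1 by rewrite gtr0_norm.
apply: (@pseries_snd_diffs _ _ r); rewrite ?(gtr0_norm r0)//.
- exact: unit_radius_cvg.
- by apply: unit_radius_cvg => //; exact: unit_radius_diffs.
- by apply: unit_radius_cvg => //; do 2 apply: unit_radius_diffs.
Qed.

(** Bounding at the right endpoint makes the estimate uniform in x on [0, y]. *)
Lemma le_psum c d x y : (forall k, `|c k| <= d k) -> unit_radius d ->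
  0 <= x <= y -> y < 1 -> `|psum c x| <= psum d y.
Proof.
move=> cd hd /andP[x0 xy] y1.
have y0 := le_trans x0 xy.
have hc := unit_radius_le cd hd.
have x1 : `|x| < 1 by rewrite ger0_norm// (le_lt_trans xy).
have yn1 : `|y| < 1 by rewrite ger0_norm.
rewrite /psum -lim_norm; last exact: unit_radius_cvg.
apply: ler_lim.
- by apply: is_cvg_norm; exact: unit_radius_cvg.
- exact: unit_radius_cvg.
- near=> n; rewrite (le_trans (ler_norm_sum _ _ _))//; apply: ler_sum => k _.
  rewrite normrM normrX (ger0_norm x0) ler_pM// ?exprn_ge0//.
  by rewrite lerXn2r.
Unshelve. all: by end_near. Qed.

End PowerSeries.

(** * Radial eigenfunctions *)

(** The binomial coefficient of L+k over k, of polynomial order k^L. *)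
Definition growth_prod (R : realType) (L : R) (k : nat) : R :=
  \prod_(j < k) (1 + L / j.+1%:R).

(** Bounds a sum of k+1 terms, each at most [growth_prod L k]: a coefficient rebuilt from its
    successive differences. *)
Definition growth_majorant (R : realType) (L : R) (k : nat) : R :=
  k.+1%:R * growth_prod L k.

(* Coefficients of the solution, equal to 1 at w = 0, of
   (1-w)(w(1-w)G'' + (nu(1+w)-2w)G') + lam G = 0.
   The second component carries the previous coefficient. *)
Fixpoint radial_coef_pair (R : realType) (nu lam : R) (k : nat) : R * R :=
  if k is k'.+1 then
    let: (b, b') := radial_coef_pair nu lam k' in
    (((2 * k'%:R ^+ 2 - lam) * b - (k'%:R - 1) * (k'%:R - nu) * b')
       / (k'.+1%:R * (k'%:R + nu)), b)
  else (1, 0).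

Definition radial_coef (R : realType) (nu lam : R) (k : nat) : R :=
  (radial_coef_pair nu lam k).1.

Section RadialCoefficients.
Variables (R : realType) (nu : R).
Hypothesis nu1 : 1 <= nu.
Implicit Types (b f : nat -> R) (L lam eta : R).

Lemma growth_prodS L k :
  growth_prod L k.+1 = growth_prod L k * (1 + L / k.+1%:R).
Proof. by rewrite /growth_prod big_ord_recr. Qed.

Lemma growth_prod_ge0 L k : 0 <= L -> 0 <= growth_prod L k.
Proof.
by move=> L0; apply: prodr_ge0 => j _; rewrite addr_ge0// divr_ge0.
Qed.

Lemma le_growth_prod L L' k : 0 <= L <= L' -> growth_prod L k <= growth_prod L' k.
Proof.
move=> /andP[L0 LL']; apply: ler_prod => j _.
by rewrite addr_ge0 ?divr_ge0//= lerD2l ler_wpM2r// invr_ge0.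
Qed.

Lemma growth_majorant_unit_radius L : 0 <= L -> unit_radius (growth_majorant L).
Proof.
move=> L0 r /andP[r0 r1]; rewrite /growth_majorant.
(* With y = k+1 >= 1, the ratio condition (y+1)(1 + L/y) r <= y follows from (y + 1 + 2L) r <= y,
   which holds for y > T. *)
pose T : R := (1 + 2 * L) / (1 - r).
pose k0 := Num.Def.archi_bound T.
apply: (@eventually_nonincr_bounded _ _ k0) => k kk.
have pk := growth_prod_ge0 k L0.
have pk1 := growth_prod_ge0 k.+1 L0.
rewrite !ger0_norm ?mulr_ge0//.
have Tk : T < k.+1%:R.
  have h1 : T < k0%:R by rewrite archi_boundP// /T divr_ge0//; lra.
  by rewrite (lt_le_trans h1)// ler_nat ltnW.
rewrite growth_prodS exprS.
have rk : 0 <= r ^+ k by rewrite exprn_ge0// ltW.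
have -> : k.+2%:R * (growth_prod L k * (1 + L / k.+1%:R)) * (r * r ^+ k) =
  (growth_prod L k * r ^+ k) * (k.+2%:R * (1 + L / k.+1%:R) * r) by ring.
rewrite [leRHS](_ : _ = (growth_prod L k * r ^+ k) * k.+1%:R); last ring.
rewrite ler_wpM2l ?mulr_ge0//.
rewrite -[k.+2%:R]natr1; move: Tk; have : 0 < k.+1%:R :> R by [].
have : 1 <= k.+1%:R :> R by rewrite ler1n.
move: (k.+1%:R : R) => y y1 y0; rewrite /T ltr_pdivrMr; last lra.
move=> h.
have -> : (y + 1) * (1 + L / y) * r = (y + 1 + L + L / y) * r by field; lra.
have Ly : L / y <= L by rewrite ler_pdivrMr// ler_peMr.
have : (y + 1 + L + L / y) * r <= (y + 1 + 2 * L) * r by rewrite ler_pM2r//; lra.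
have : (1 + 2 * L) * r <= 1 + 2 * L by rewrite ler_piMr; lra.
by lra.
Qed.

(* The recurrence has the double characteristic root 1: bounding its terms
   directly loses the unit radius, so the differences are estimated as well. *)
Lemma coef_bound (kap L eta : R) b f :
  `|kap| <= L -> 0 <= eta -> `|b 0%N| <= eta ->
  (forall k, `|f k| <= eta * growth_majorant L k) ->
  (forall k, k.+1%:R * (k%:R + nu) * (b k.+1 - b k) =
     (k%:R - 1) * (k%:R - nu) * (b k - shift_coef b k) - kap * b k - f k) ->
  forall k, `|b k| <= eta * growth_majorant (L + 1) k.
Proof.
move=> kL e0 b0 hf rec k.
have L0 : 0 <= L by rewrite (le_trans _ kL).
(* Joint induction. Since |(k-1)(k-nu)| <= (k+1)(k+nu), the differences grow only through [kap] and
   [f]; these add (L+1)(k+1) times the bound, hence a factor 1 + (L+1)/(k+1). *)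
suff : `|b k| <= eta * growth_majorant (L + 1) k /\
       `|b k - shift_coef b k| <= eta * growth_prod (L + 1) k by case.
elim: k => [|k [IHb IHd]].
  by rewrite /= subr0 /growth_majorant /growth_prod !big_ord0 !mulr1.
have P0 := growth_prod_ge0 k (addr_ge0 L0 ler01).
have hd : `|b k.+1 - b k| <= eta * growth_prod (L + 1) k.+1.
  have A0 : 0 < k.+1%:R * (k%:R + nu) :> R.
    by rewrite mulr_gt0// ltr_wpDl// (lt_le_trans ltr01).
  rewrite -(ler_pM2l A0) -{1}(gtr0_norm A0) -normrM rec.
  have fk : `|f k| <= eta * (k.+1%:R * growth_prod (L + 1) k).
    rewrite (le_trans (hf k))// ler_wpM2l// ler_wpM2l// le_growth_prod//.
    by rewrite L0/= lerDl.
  have cA : `|(k%:R - 1) * (k%:R - nu)| <= k.+1%:R * (k%:R + nu) :> R.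
    rewrite ler_norml -[k.+1%:R]natr1.
    have : 0 <= k%:R :> R by [].
    by move: (k%:R : R) nu1 => y n1 y0; apply/andP; split; nra.
  rewrite growth_prodS.
  have : `|(k%:R - 1) * (k%:R - nu) * (b k - shift_coef b k)| <=
      k.+1%:R * (k%:R + nu) * (eta * growth_prod (L + 1) k).
    by rewrite normrM ler_pM.
  have : `|kap * b k| <= L * (eta * (k.+1%:R * growth_prod (L + 1) k)).
    by rewrite normrM ler_pM.
  move=> h1 h2.
  rewrite (le_trans (ler_normB _ _))//.
  rewrite (le_trans (lerD (ler_normB _ _) (lexx _)))//.
  rewrite (le_trans (lerD (lerD h2 h1) fk))//.
  have kn : k.+1%:R <= k%:R + nu by rewrite -natr1 lerD2l.
  have k1 : 0 < k.+1%:R :> R by [].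
  move: P0 kn k1 A0; clear -e0 L0; move: (growth_prod _ _) (k.+1%:R : R) (k%:R + nu).
  move=> P y z P0 yz y0 zy.
  have -> : y * z * (eta * (P * (1 + (L + 1) / y))) =
    y * z * (eta * P) + z * ((L + 1) * (eta * P)) by field; lra.
  have Z : 0 <= (L + 1) * (eta * P) by rewrite !mulr_ge0// addr_ge0.
  have : y * ((L + 1) * (eta * P)) <= z * ((L + 1) * (eta * P)) by rewrite ler_wpM2r.
  by lra.
split; last exact: hd.
rewrite -(subrK (b k) (b k.+1)) (le_trans (ler_normD _ _))//.
rewrite (le_trans (lerD hd IHb))// -mulrDr ler_wpM2l// /growth_majorant.
rewrite -[k.+2%:R]natr1 mulrDl mul1r addrC lerD2r ler_wpM2l//.
by rewrite growth_prodS ler_peMr// lerDl divr_ge0// addr_ge0.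
Qed.

Lemma radial_coef_rec lam k :
  k.+1%:R * (k%:R + nu) * radial_coef nu lam k.+1 =
  (2 * k%:R ^+ 2 - lam) * radial_coef nu lam k -
  (k%:R - 1) * (k%:R - nu) * shift_coef (radial_coef nu lam) k.
Proof.
have -> : shift_coef (radial_coef nu lam) k = (radial_coef_pair nu lam k).2.
  by case: k => //= k; rewrite /radial_coef; case: radial_coef_pair.
rewrite /radial_coef /=; case: radial_coef_pair => b b' /=.
have kn : k%:R + nu != 0 by rewrite gt_eqF// ltr_wpDl// (lt_le_trans ltr01).
by rewrite [LHS]mulrC divfK// mulf_neq0.
Qed.

(** Written in differences, the recurrence splits off the root 1 and leaves 2 nu + lam as the only
    perturbation, the form that [coef_bound] takes. *)
Lemma radial_coef_diff lam k :
  k.+1%:R * (k%:R + nu) * (radial_coef nu lam k.+1 - radial_coef nu lam k) =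
  (k%:R - 1) * (k%:R - nu) *
     (radial_coef nu lam k - shift_coef (radial_coef nu lam) k)
  - (2 * nu + lam) * radial_coef nu lam k.
Proof.
rewrite mulrBr radial_coef_rec -[k.+1%:R]natr1; ring.
Qed.

End RadialCoefficients.

(** * Directional derivatives *)

Section DerivativeRules.
Variables (R : realType) (V : normedModType R).
Implicit Types (f g : V -> R) (x v : V).

Lemma is_derive_change f x v (df df' : R) :
  is_derive x v f df -> df = df' -> is_derive x v f df'.
Proof. by move=> ? <-. Qed.

Lemma is_derive_add f g x v (df dg : R) :
  is_derive x v f df -> is_derive x v g dg ->
  is_derive x v (fun y => f y + g y) (df + dg).
Proof. by move=> hf hg; exact: is_deriveD. Qed.

Lemma is_derive_opp f x v (df : R) :
  is_derive x v f df -> is_derive x v (fun y => - f y) (- df).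
Proof. by move=> hf; exact: is_deriveN. Qed.

Lemma is_derive_const (c : R) x v : is_derive x v (fun=> c) 0.
Proof. exact: is_derive_cst. Qed.

Lemma is_derive_mul f g x v (df dg : R) :
  is_derive x v f df -> is_derive x v g dg ->
  is_derive x v (fun y => f y * g y) (df * g x + f x * dg).
Proof.
move=> hf hg; have h := is_deriveM hf hg; apply: is_derive_change h _.
by rewrite addrC [df * _]mulrC.
Qed.

(** A directional derivative is the derivative at 0 of a function of one real variable; the chain
    rule is inherited from there. *)
Lemma is_derive_along f x v (df : R) :
  is_derive x v f df <-> is_derive (0 : R) 1 (fun h => f (h *: v + x)) df.
Proof.
have e : (fun h : R => h^-1 *: ((f \o shift x) (h *: v) - f x)) =
   (fun h : R => h^-1 *: (((fun h => f (h *: v + x)) \o shift 0) (h *: 1) -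
     (fun h => f (h *: v + x)) 0)).
  apply/funext => h /=; rewrite /shift/= addr0 scale0r add0r.
  by rewrite [h *: 1]mulr1.
by split => -[d1 d2]; split; move: d1 d2; rewrite /derivable /derive e.
Qed.

Lemma is_derive_chain (g : R -> R) f x v (dg df : R) :
  is_derive (f x) 1 g dg -> is_derive x v f df ->
  is_derive x v (fun y => g (f y)) (dg * df).
Proof.
move=> hg /is_derive_along hf; apply/is_derive_along.
have hg' : is_derive (f (0 *: v + x)) 1 g dg by rewrite scale0r add0r.
exact: is_derive1_comp hg' hf.
Qed.

Lemma is_derive_pow f n x v (df : R) : is_derive x v f df ->
  is_derive x v (fun y => f y ^+ n) (n%:R * f x ^+ n.-1 * df).
Proof.
move=> h; have -> : (fun y => f y ^+ n) = f ^+ n by apply/funext => y; rewrite exprfctE.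
exact: is_deriveX.
Qed.

Lemma is_derive_inv f x v (df : R) : f x != 0 -> is_derive x v f df ->
  is_derive x v (fun y => (f y)^-1) (- df / f x ^+ 2).
Proof.
move=> f0 [h1 h2]; split; first exact: derivableV.
by rewrite (deriveV f0 h1) h2 [LHS]mulNr mulrC mulNr.
Qed.

Lemma is_derive_bigsum n (f : 'I_n -> V -> R) x v (df : 'I_n -> R) :
  (forall i, is_derive x v (f i) (df i)) ->
  is_derive x v (fun y => \sum_(i < n) f i y) (\sum_(i < n) df i).
Proof.
move=> h; have := is_derive_sum h.
by have -> : \sum_(i < n) f i = (fun y => \sum_(i < n) f i y)
  by apply/funext => y; rewrite fct_sumE.
Qed.

End DerivativeRules.

(** Differentiation by syntax. Derivatives of unknown functions are looked up in the context, and
    each inverse leaves a goal that its argument is nonzero; [derive] then leaves the equality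
    between the computed and the stated derivative. *)
Ltac derive_rules :=
  lazymatch goal with
  | |- is_derive _ _ (fun=> ?c) _ => exact: is_derive_const
  | |- is_derive _ _ (fun y => y) _ => exact: is_derive_id
  | |- is_derive _ _ (fun y => GRing.add (@?a y) (@?b y)) _ =>
      notypeclasses refine (is_derive_add (f := a) (g := b) _ _); derive_rules
  | |- is_derive _ _ (fun y => GRing.opp (@?a y)) _ =>
      notypeclasses refine (is_derive_opp (f := a) _); derive_rules
  | |- is_derive _ _ (fun y => GRing.mul (@?a y) (@?b y)) _ =>
      notypeclasses refine (is_derive_mul (f := a) (g := b) _ _); derive_rules
  | |- is_derive _ _ (fun y => GRing.exp (@?a y) ?n) _ =>
      notypeclasses refine (is_derive_pow (f := a) n _); derive_rules
  | |- is_derive _ _ (fun y => GRing.inv (@?a y)) _ =>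
      notypeclasses refine (is_derive_inv (f := a) _ _); [ | derive_rules]
  | |- is_derive _ _ (fun y => expR (@?a y)) _ =>
      notypeclasses refine (is_derive_chain (f := a) (is_derive_expR _) _);
      derive_rules
  | |- is_derive _ _ (fun y => sin (@?a y)) _ =>
      notypeclasses refine (is_derive_chain (f := a) (is_derive_sin _) _);
      derive_rules
  | |- is_derive _ _ (fun y => cos (@?a y)) _ =>
      notypeclasses refine (is_derive_chain (f := a) (is_derive_cos _) _);
      derive_rules
  | |- is_derive _ _ (fun y => ?g (@?a y)) _ =>
      first [eassumption
            | notypeclasses refine (is_derive_chain (f := a) _ _);
              [eassumption | derive_rules]]
  | |- _ => first [eassumption | idtac]
  end.

Ltac derive :=
  notypeclasses refine (is_derive_change _ _); [derive_rules | ..]; cbv beta.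

Lemma derive_continuous (R : realType) (f : R -> R) (x df : R) :
  is_derive x 1 f df -> {for x, continuous f}.
Proof.
by case=> d _; exact/differentiable_continuous/derivable1_diffP.
Qed.

(** The substitute for integration: [f] plays the primitive, [df] the nonnegative integrand. *)
Lemma le_of_derive_ge0 (R : realType) (f df : R -> R) (a b : R) : a <= b ->
  (forall x, a <= x <= b -> is_derive x 1 f (df x)) ->
  (forall x, a < x < b -> 0 <= df x) -> f a <= f b.
Proof.
move=> ab d d0.
have h : {within `[a, b], continuous f}.
  apply: continuous_in_subspaceT => y /[!inE]/=.
  by rewrite in_itv/= => /d; exact: derive_continuous.
have := @ger0_derive1_le_cc R f a b _ _ h a b.
rewrite !in_itv/= !lexx ab/=; apply => //.
  by move=> x /[!in_itv]/=/andP[ax xb]; case: (d x) => //; rewrite !ltW.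
move=> x /[!in_itv]/= xab; rewrite derive1E.
have [ax xb] := andP xab.
by case: (d x); [rewrite !ltW|move=> _ ->; exact: d0].
Qed.

(* For X = cosh t - 1 this is tanh^2(t/2). It sends the singular points 0, oo, -2
   of the radial equation to 0, 1, oo, so that the series reaches all X >= 0. *)
Definition disc_var (R : realType) (X : R) : R := X / (X + 2).

(* 2 nu is the dimension, not necessarily an integer. *)
Definition radial (R : realType) (nu lam X : R) : R :=
  psum (radial_coef nu lam) (disc_var X).

Definition radial1 (R : realType) (nu lam X : R) : R :=
  psum (pseries_diffs (radial_coef nu lam)) (disc_var X) * (2 / (X + 2) ^+ 2).

Definition radial2 (R : realType) (nu lam X : R) : R :=
  psum (pseries_diffs (pseries_diffs (radial_coef nu lam))) (disc_var X)
    * (4 / (X + 2) ^+ 4)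
  - psum (pseries_diffs (radial_coef nu lam)) (disc_var X) * (4 / (X + 2) ^+ 3).

(** * The radial equation and the dependence of its solution on the eigenvalue *)

Section Radial.
Variables (R : realType) (nu : R).
Hypothesis nu1 : 1 <= nu.
Implicit Types (lam w X : R).

Lemma radial_coef_unit_radius lam : unit_radius (radial_coef nu lam).
Proof.
have L0 : 0 <= `|2 * nu + lam| + 1 by rewrite addr_ge0.
apply: unit_radius_le (growth_majorant_unit_radius L0) => k.
rewrite -[leRHS]mul1r.
apply: (@coef_bound _ _ nu1 (2 * nu + lam) _ _ _ (fun=> 0)) => //=.
- by rewrite normr1.
- move=> j; rewrite normr0 mulr_ge0// mulr_ge0//.
  exact: growth_prod_ge0.
- by move=> j; rewrite subr0 radial_coef_diff.
Qed.

Lemma radial_coef_ode lam w : `|w| < 1 ->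
  let b := radial_coef nu lam in
  let b1 := pseries_diffs b in
  w * (1 - w) ^+ 2 * psum (pseries_diffs b1) w
  + (1 - w) * (nu * (1 + w) - 2 * w) * psum b1 w + lam * psum b w = 0.
Proof.
move=> w1 b b1; set b2 := pseries_diffs b1.
have hb : unit_radius b := radial_coef_unit_radius lam.
have hb1 : unit_radius b1 by exact: unit_radius_diffs.
have hb2 : unit_radius b2 by exact: unit_radius_diffs.
pose S : (nat -> R) -> nat -> R := @shift_coef R.
have hs c : unit_radius c -> unit_radius (S c) := @unit_radius_shift R c.
(* The polynomials w - 2w^2 + w^3 and nu - 2w + (2-nu) w^2 of the equation act as combinations of
   shifts; the recurrence annihilates every coefficient of the sum. *)
have := @psum0 R (fun k => S b2 k + (- 2 * S (S b2) k + (S (S (S b2)) k +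
   (nu * b1 k + (- 2 * S b1 k + ((2 - nu) * S (S b1) k + lam * b k)))))) w.
have rD := @unit_radiusD R; have rZ := @unit_radiusZ R.
rewrite !psumD ?psumZ ?psum_shift //.
move=> h; rewrite -[RHS]h; first by rewrite /S; ring.
have rec k := radial_coef_rec nu1 lam k.
rewrite -/b in rec.
rewrite /S /b2 /b1 /pseries_diffs.
(* The triple shift takes its default value 0 at the first three indices. *)
case=> [|[|[|k]]] /=.
- by have := rec 0%N; rewrite /=; lra.
- by have := rec 1%N; rewrite /=; lra.
- by have := rec 2%N; rewrite /=; lra.
- have := rec k.+3; rewrite /= -![k.+4%:R]natr1 -![k.+3%:R]natr1.
  rewrite -![k.+2%:R]natr1 -![k.+1%:R]natr1 => e.
  by apply/eqP; rewrite -subr_eq0 subr0 -[X in X == _]subr0; apply/eqP; nra.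
all: by repeat first [exact hb|exact hb1|exact hb2|apply hs|apply rD|apply rZ].
Qed.

Lemma disc_var_lt1 X : -1 < X -> `|disc_var X| < 1.
Proof.
move=> X1; have X2 : 0 < X + 2 by lra.
rewrite /disc_var normrM normfV (gtr0_norm X2) ltr_pdivrMr// mul1r ltr_norml.
by apply/andP; split; lra.
Qed.

Lemma is_derive_disc_var X : -1 < X ->
  is_derive X 1 (@disc_var R) (2 / (X + 2) ^+ 2).
Proof.
move=> X1; rewrite /disc_var; derive; first by rewrite gt_eqF//; lra.
by field; lra.
Qed.

Lemma is_derive_radial lam X : -1 < X ->
  is_derive X 1 (radial nu lam) (radial1 nu lam X).
Proof.
move=> X1; rewrite /radial /radial1; apply: is_derive_chain.
  apply: is_derive_psum; last exact: disc_var_lt1.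
  exact: radial_coef_unit_radius.
exact: is_derive_disc_var.
Qed.

Lemma is_derive_radial1 lam X : -1 < X ->
  is_derive X 1 (radial1 nu lam) (radial2 nu lam X).
Proof.
move=> X1; rewrite /radial1 /radial2.
have hw := is_derive_disc_var X1.
have hb : unit_radius (pseries_diffs (radial_coef nu lam)).
  by apply: unit_radius_diffs; exact: radial_coef_unit_radius.
have hd := is_derive_chain (is_derive_psum hb (disc_var_lt1 X1)) hw.
derive; first by rewrite expf_eq0/=; lra.
by rewrite /=; field; lra.
Qed.

Lemma derivable_radial2 lam X : -1 < X -> derivable (radial2 nu lam) X 1.
Proof.
move=> X1.
have hw := is_derive_disc_var X1.
have hb1 : unit_radius (pseries_diffs (radial_coef nu lam)).
  by apply: unit_radius_diffs; exact: radial_coef_unit_radius.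
have hd1 := is_derive_chain (is_derive_psum hb1 (disc_var_lt1 X1)) hw.
have hd2 := is_derive_chain
  (is_derive_psum (unit_radius_diffs hb1) (disc_var_lt1 X1)) hw.
suff [df h] : exists df, is_derive X 1 (radial2 nu lam) df by case: h.
eexists; rewrite /radial2; derive; last reflexivity.
all: by rewrite expf_eq0/=; lra.
Qed.

(** With X = cosh t - 1, the factor X^2 + 2X is sinh^2 t and X + 1 is cosh t: this is the radial
    Laplace eigenvalue equation in dimension 2 nu, pulled back from w by 1 - w = 2/(X+2). *)
Lemma radial_ode lam X : -1 < X ->
  (X ^+ 2 + 2 * X) * radial2 nu lam X
  + 2 * nu * (X + 1) * radial1 nu lam X + lam * radial nu lam X = 0.
Proof.
move=> X1; have := radial_coef_ode lam (disc_var_lt1 X1).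
rewrite /radial2 /radial1 /radial /=.
move: (psum _ _) (psum _ _) (psum _ _) => G2 G1 G <-.
by rewrite /disc_var; field; lra.
Qed.

Lemma radial_at0 lam : radial nu lam 0 = 1.
Proof. by rewrite /radial /disc_var mul0r psum_at0. Qed.

(** Constants are harmonic; this is where the shooting starts. Two consecutive coefficients vanish
    together because the recurrence has two steps. *)
Lemma radial_eigen0 X : -1 < X -> radial nu 0 X = 1.
Proof.
move=> X1; rewrite /radial.
have A0 (j : nat) : j.+1%:R * (j%:R + nu) != 0.
  by rewrite gt_eqF// mulr_gt0// ltr_wpDl// (lt_le_trans ltr01).
have c0 k : radial_coef nu 0 k.+1 = 0 /\ radial_coef nu 0 k.+2 = 0.
  elim: k => [|k [c1 c2]].
    have c1 : radial_coef nu 0 1 = 0.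
      apply: (mulfI (A0 0%N)); rewrite mulr0 radial_coef_rec//=; ring.
    split => //; apply: (mulfI (A0 1%N)); rewrite mulr0 radial_coef_rec//= c1; ring.
  split => //; apply: (mulfI (A0 k.+2)).
  by rewrite mulr0 radial_coef_rec//= c1 c2; ring.
rewrite (_ : radial_coef nu 0 = (fun k => (k == 0%N)%:R)); last first.
  by apply/funext => -[|k] //; case: (c0 k).
rewrite /psum; apply: cvg_lim => //; rewrite -cvg_shiftS.
rewrite (_ : (fun n => _) = cst 1); first exact: cvg_cst.
apply/funext => n; rewrite /pseries/series/= big_nat_recl//= expr0 mulr1.
by rewrite big1 ?addr0// => i _; rewrite mul0r.
Qed.

(** The difference of the coefficient sequences for lam and lam' obeys the recurrence for lam with
    the forcing term (lam - lam') times the coefficients for lam'. Bounding first these and then the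
    difference raises the growth parameter twice, from L to L + 2. *)
Lemma le_radial_diff (lmax M : R) : 0 <= lmax -> 0 <= M ->
  exists2 C : R, 0 <= C & forall lam lam' X,
    0 <= lam <= lmax -> 0 <= lam' <= lmax -> 0 <= X <= M ->
    `|radial nu lam X - radial nu lam' X| <= `|lam - lam'| * C.
Proof.
move=> lm0 M0; have nu_ge1 := nu1; pose L := 2 * nu + lmax.
have L0 : 0 <= L by rewrite /L; lra.
have hM : unit_radius (growth_majorant (L + 1 + 1)).
  by apply: growth_majorant_unit_radius; lra.
pose y := disc_var M.
have y0 : 0 <= y by rewrite /y /disc_var divr_ge0//; lra.
have y1 : y < 1.
  by rewrite (le_lt_trans (ler_norm _))// disc_var_lt1//; lra.
exists (psum (growth_majorant (L + 1 + 1)) y).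
  rewrite -(normr0 R) -(@psum0 R (fun=> 0) y)//.
  apply: le_psum => //; last by rewrite y0 lexx.
  by move=> k; rewrite normr0 mulr_ge0// growth_prod_ge0//; lra.
move=> l l' X /andP[l0 lm] /andP[l'0 l'm] /andP[X0 XM].
have Xy : 0 <= disc_var X <= y.
  rewrite /y /disc_var divr_ge0 ?addr_ge0//= ler_pdivrMr; last lra.
  rewrite mulrAC ler_pdivlMr; last lra.
  nra.
have X1 : `|disc_var X| < 1 by apply: disc_var_lt1; lra.
have hb := radial_coef_unit_radius.
have hd : unit_radius (fun k => radial_coef nu l k + -1 * radial_coef nu l' k).
  by apply: unit_radiusD => //; apply: unit_radiusZ.
have -> : radial nu l X - radial nu l' X =
    psum (fun k => radial_coef nu l k + -1 * radial_coef nu l' k) (disc_var X).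
  rewrite psumD ?psumZ//; last exact: unit_radiusZ.
  by rewrite mulN1r.
have nk a : 0 <= a <= lmax -> `|2 * nu + a| <= L.
  by move=> /andP[a0 am]; rewrite ger0_norm /L; lra.
have bl k : `|radial_coef nu l' k| <= 1 * growth_majorant (L + 1) k.
  apply: (@coef_bound _ _ nu1 (2 * nu + l') L _ _ (fun=> 0)) => //.
  - by rewrite nk// l'0.
  - by rewrite /radial_coef/= normr1.
  - by move=> j; rewrite normr0 !mulr_ge0// growth_prod_ge0.
  - by move=> j; rewrite subr0 radial_coef_diff.
have dk k : `|radial_coef nu l k + -1 * radial_coef nu l' k| <=
    `|l - l'| * growth_majorant (L + 1 + 1) k.
  apply: (@coef_bound _ _ nu1 (2 * nu + l) (L + 1) _
    (fun k => radial_coef nu l k + -1 * radial_coef nu l' k)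
    (fun k => (l - l') * radial_coef nu l' k)) => //.
  - by rewrite (le_trans (nk _ _)) ?l0// lerDl.
  - by rewrite /radial_coef/= mulN1r subrr normr0.
  - by move=> j; rewrite normrM ler_wpM2l// -[leRHS]mul1r.
  - move=> j.
    have h := radial_coef_diff nu1 l j; have h' := radial_coef_diff nu1 l' j.
    have -> : shift_coef (fun k => radial_coef nu l k + -1 * radial_coef nu l' k) j =
      shift_coef (radial_coef nu l) j + -1 * shift_coef (radial_coef nu l') j.
      by case: j {h h'} => //=; rewrite mulr0 addr0.
    transitivity (j.+1%:R * (j%:R + nu) *
       (radial_coef nu l j.+1 - radial_coef nu l j) -
      j.+1%:R * (j%:R + nu) *
       (radial_coef nu l' j.+1 - radial_coef nu l' j)); first by ring.
    by rewrite h h'; ring.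
rewrite (le_trans (le_psum dk _ Xy y1))//; first exact: unit_radiusZ.
by rewrite psumZ// ger0_norm.
Qed.

End Radial.

(** * The sum of inverse squares *)

Section Basel.
Variable R : realType.
Implicit Types (x : R).

Lemma csc2_double x : sin x != 0 -> cos x != 0 ->
  sin x ^- 2 + cos x ^- 2 = 4 * sin (x *+ 2) ^- 2 :> R.
Proof.
move=> s0 c0; rewrite sin_mulr2n -mulr_natl.
have -> : sin x ^- 2 + cos x ^- 2 =
    (cos x ^+ 2 + sin x ^+ 2) * (sin x ^- 2 * cos x ^- 2) by field; apply/andP.
by rewrite cos2Dsin2; field; apply/andP.
Qed.

(** Each step of the induction halves the angles. The angles of index k and 2^n + k differ by pi/2,
    so that sine becomes cosine and the pair merges by the doubling formula. *)
Lemma sum_csc2 n x : 0 < x < pi ->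
  \sum_(k < 2 ^ n) sin ((x + k%:R * pi) / 2 ^+ n) ^- 2 = 4 ^+ n * sin x ^- 2.
Proof.
move=> x0p; elim: n => [|n IH].
  by rewrite big_ord1 expr0 !mul1r mul0r addr0 divr1.
rewrite expnS mul2n -addnn big_split_ord/= -big_split/= [4 ^+ n.+1]exprS -mulrA -IH mulr_sumr.
apply: eq_bigr => k _.
have n0 : (2 : R) ^+ n != 0 by rewrite expf_eq0 pnatr_eq0 andbF.
set y := (x + k%:R * pi) / 2 ^+ n.+1.
have -> : (x + (2 ^ n + k)%:R * pi) / 2 ^+ n.+1 = y + pi / 2.
  by rewrite /y natrD natrX exprS; field.
rewrite sinDpihalf.
have -> : (x + k%:R * pi) / 2 ^+ n = y *+ 2.
  by rewrite /y exprS -mulr_natl; field.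
have pi0 := pi_gt0 R.
have [x0 xpi] := andP x0p.
have y0 : 0 < y.
  by rewrite divr_gt0 ?exprn_gt0// ltr_wpDr// mulr_ge0// ltW.
have y1 : y < pi / 2.
  rewrite /y ltr_pdivrMr ?exprn_gt0// exprS.
  have -> : pi / 2 * (2 * 2 ^+ n) = 2 ^+ n * pi :> R by field.
  rewrite (@lt_le_trans _ _ (k.+1%:R * pi))//.
    by rewrite -[k.+1%:R]natr1 mulrDl mul1r addrC ltrD2l.
  by rewrite ler_wpM2r ?(ltW pi0)// -natrX ler_nat.
apply: csc2_double; rewrite gt_eqF//.
  by apply: sin_gt0_pihalf; rewrite y0.
by apply: cos_gt0_pihalf; rewrite y1 andbT (lt_trans _ y0)// oppr_lt0 divr_gt0.
Qed.

Lemma sin_le x : 0 <= x -> sin x <= x.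
Proof.
move=> x0; have d (y : R) : is_derive y 1 (fun y => y - sin y) (1 - cos y).
  by derive; ring.
have := le_of_derive_ge0 x0 (fun y _ => d y); rewrite sin0 => h.
suff : 0 - 0 <= x - sin x by lra.
by apply: h => y _; rewrite subr_ge0 cos_le1.
Qed.

(** At x = pi/2 the angles are (2k+1) pi/2^(M+2). Reflection at pi/2 makes the two halves of the sum
    equal, and sin y <= y replaces csc^2 y by 1/y^2 from below. Enlarging the sum from M to 2^M
    terms is harmless, its terms being nonnegative. *)
Lemma sum_odd_inv_sqr (M : nat) :
  \sum_(k < M) (k%:R *+ 2 + 1) ^- 2 <= pi ^+ 2 / 8 :> R.
Proof.
pose N := (2 ^ M)%N.
have MN : (M <= N)%N by exact/ltnW/ltn_expl.
apply: (@le_trans _ _ (\sum_(k < N) (k%:R *+ 2 + 1) ^- 2)).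
  rewrite -(subnKC MN) big_split_ord/= lerDl; apply: sumr_ge0 => i _.
  by rewrite invr_ge0 exprn_ge0// addr_ge0// mulrn_wge0.
have pi0 := pi_gt0 R.
have := @sum_csc2 M.+1 (pi / 2).
have -> : 0 < (pi / 2 : R) < pi.
  by apply/andP; split; [rewrite divr_gt0|rewrite ltr_pdivrMr// ltr_pMr// ltr1n].
rewrite sin_pihalf expr1n invr1 mulr1 => /(_ isT).
rewrite expnS mul2n -addnn big_split_ord/= -/N.
have n0 : 0 < (2 : R) ^+ M by rewrite exprn_gt0.
pose th (k : nat) : R := (k%:R *+ 2 + 1) * (pi / 2 ^+ M.+2).
have th0 k : 0 < th k.
  by rewrite mulr_gt0 ?divr_gt0 ?exprn_gt0// ltr_wpDl// mulrn_wge0.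
have thpi (k : 'I_N) : th k < pi / 2.
  rewrite /th !exprS mulrA ltr_pdivrMr ?mulr_gt0//.
  have -> : pi / 2 * (2 * (2 * 2 ^+ M)) = (2 * 2 ^+ M) * pi :> R by field.
  rewrite ltr_pM2r// -natrX -/N -mulr_natl -[2 * k%:R]natrM -[2 * N%:R]natrM natr1.
  by rewrite ltr_nat; have := ltn_ord k; lia.
have sinth (k : 'I_N) : th k ^- 2 <= sin (th k) ^- 2.
  have s0 : 0 < sin (th k) by apply: sin_gt0_pihalf; rewrite th0 thpi.
  rewrite lef_pV2 ?posrE ?exprn_gt0//.
  by rewrite lerXn2r ?nnegrE ?(ltW (th0 _)) ?(ltW s0)// sin_le// ltW.
have e1 : \sum_(k < N) sin ((pi / 2 + k%:R * pi) / 2 ^+ M.+1) ^- 2 =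
          \sum_(k < N) sin (th k) ^- 2.
  apply: eq_bigr => k _; congr (sin _ ^- 2); rewrite /th -mulr_natl !exprS.
  by field; rewrite gt_eqF.
have e2 : \sum_(k < N) sin ((pi / 2 + (N + k)%:R * pi) / 2 ^+ M.+1) ^- 2 =
          \sum_(k < N) sin (th k) ^- 2.
  rewrite (reindex_inj rev_ord_inj)/=; apply: eq_bigr => k _.
  have -> : (N + (N - k.+1))%N = (2 * N - k.+1)%N by have := ltn_ord k; lia.
  have -> : (pi / 2 + (2 * N - k.+1)%:R * pi) / 2 ^+ M.+1 = pi - th k.
    rewrite natrB; last by have := ltn_ord k; lia.
    rewrite natrM /N natrX -[k.+1%:R]natr1 /th -[_ *+ 2]mulr_natl !exprS.
    by field; rewrite gt_eqF.
  by rewrite sinB sinpi cospi mul0r sub0r mulN1r opprK.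
rewrite e1 e2 => e.
have : \sum_(k < N) th k ^- 2 <= 4 ^+ M.+1 / 2.
  have h : \sum_(k < N) th k ^- 2 <= \sum_(k < N) sin (th k) ^- 2.
    by apply: ler_sum => k _; exact: sinth.
  by rewrite -e; lra.
have -> : \sum_(k < N) th k ^- 2 =
   (4 * 4 ^+ M.+1 / pi ^+ 2) * \sum_(k < N) (k%:R *+ 2 + 1) ^- 2.
  rewrite mulr_sumr; apply: eq_bigr => k _; rewrite /th.
  have -> : 4 * 4 ^+ M.+1 = (2 ^+ M.+2) ^+ 2 :> R.
    by rewrite -exprS -exprM mulnC exprM; congr (_ ^+ _); ring.
  have k0 : k%:R *+ 2 + 1 != 0 :> R by rewrite gt_eqF// ltr_wpDl// mulrn_wge0.
  have M2 : 2 ^+ M.+2 != 0 :> R by rewrite gt_eqF// exprn_gt0.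
  move: (2 ^+ _ : R) (k%:R *+ 2 + 1 : R) (pi : R) M2 k0 (lt0r_neq0 pi0).
  by move=> a b p a0 b0 p0; field; rewrite b0 p0.
have c0 : 0 < 4 * 4 ^+ M.+1 / pi ^+ 2 :> R by rewrite divr_gt0 ?mulr_gt0 ?exprn_gt0.
rewrite -ler_pdivlMl// => /le_trans; apply.
rewrite le_eqVlt; apply/orP; left; apply/eqP.
have : (4 : R) ^+ M.+1 != 0 by rewrite gt_eqF// exprn_gt0.
move: (4 ^+ M.+1 : R) (pi : R) (lt0r_neq0 pi0) => a p p0 a0.
by field; rewrite a0 p0.
Qed.

(** Splitting by parity gives T(2K) = odd part + T(K)/4; as T(K) <= T(2K), three quarters of T(K)
    are at most pi^2/8. *)
Lemma sum_inv_sqr_le (K : nat) : \sum_(k < K) k.+1%:R ^- 2 <= pi ^+ 2 / 6 :> R.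
Proof.
pose T K : R := \sum_(k < K) k.+1%:R ^- 2.
have mono K1 K2 : (K1 <= K2)%N -> T K1 <= T K2.
  move=> h; rewrite /T -(subnKC h) big_split_ord/= lerDl; apply: sumr_ge0 => i _.
  by rewrite invr_ge0 exprn_ge0.
have split2 M : T M.*2 = \sum_(k < M) (k%:R *+ 2 + 1) ^- 2 + T M / 4.
  elim: M => [|M IH]; first by rewrite /T !big_ord0 mul0r addr0.
  rewrite /T doubleS !big_ord_recr/= -/(T _) IH -/(T M).
  have -> : M.*2.+1%:R = M%:R *+ 2 + 1 :> R by rewrite -natr1 -muln2 natrM mulr_natr.
  have -> : M.*2.+2%:R = 2 * M.+1%:R :> R by rewrite -doubleS -mul2n natrM.
  have -> : (2 * M.+1%:R) ^- 2 = M.+1%:R ^- 2 / 4 :> R.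
    by rewrite exprMn invfM mulrC; congr (_ / _); ring.
  by rewrite mulrDl addrA; congr (_ + _); rewrite -!addrA; congr (_ + _); exact: addrC.
have h := sum_odd_inv_sqr K.
have := split2 K; have := mono K K.*2 _; rewrite -addnn leq_addr => /(_ isT).
by rewrite /T; lra.
Qed.

End Basel.

(** * Hyperbolic functions and the integral of t^2/sinh^2 t *)

Definition cosh (R : realType) (x : R) : R := (expR x + expR (- x)) / 2.

Section Hyperbolic.
Variable R : realType.
Implicit Types t r : R.

Lemma is_derive_sinh t : is_derive t 1 (@sinh R) (cosh t).
Proof. by rewrite /sinh /cosh; derive; field. Qed.

Lemma is_derive_cosh t : is_derive t 1 (@cosh R) (sinh t).
Proof. by rewrite /sinh /cosh; derive; field. Qed.

Lemma cosh2_sinh2 t : cosh t ^+ 2 = sinh t ^+ 2 + 1.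
Proof.
have e : expR t * expR (- t) = 1 by rewrite -expRD subrr expR0.
rewrite /cosh /sinh !expr_div_n sqrrD sqrrB e; by field.
Qed.

Lemma sinh0 : sinh 0 = 0 :> R.
Proof. by rewrite /sinh oppr0 subrr mul0r. Qed.

Lemma cosh_gt0 t : 0 < cosh t.
Proof. by rewrite divr_gt0// addr_gt0// expR_gt0. Qed.

Lemma sinh_ge0 t : 0 <= t -> 0 <= sinh t.
Proof. by move=> t0; rewrite divr_ge0// subr_ge0 ler_expR; lra. Qed.

Lemma sinh_gt0 t : 0 < t -> 0 < sinh t.
Proof. by move=> t0; rewrite divr_gt0// subr_gt0 ltr_expR; lra. Qed.

Lemma cosh_ge1 t : 1 <= cosh t.
Proof.
rewrite -(@ler_pXn2r _ 2)// ?nnegrE ?(ltW (cosh_gt0 t))// cosh2_sinh2 expr1n.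
by rewrite lerDr sqr_ge0.
Qed.

Lemma le_sinh t : 0 <= t -> t <= sinh t.
Proof.
move=> t0; have d (y : R) : is_derive y 1 (fun y => sinh y - y) (cosh y - 1).
  by have hs := is_derive_sinh y; derive.
have := le_of_derive_ge0 t0 (fun y _ => d y); rewrite sinh0 => h.
suff : 0 - 0 <= sinh t - t by lra.
by apply: h => y _; rewrite subr_ge0 cosh_ge1.
Qed.

(** Read as 1/sinh^2 t = 4x/(1-x)^2, the generating function of the numbers 4j. *)
Lemma sinh2E t : let x := expR (- (2 * t)) in 4 * x * sinh t ^+ 2 = (1 - x) ^+ 2.
Proof.
have -> : expR (- (2 * t)) = expR (- t) ^+ 2 by rewrite expr2 -expRD; congr expR; ring.
have e : expR t * expR (- t) = 1 by rewrite -expRD subrr expR0.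
rewrite /= /sinh.
transitivity ((expR t * expR (- t) - expR (- t) ^+ 2) ^+ 2); last by rewrite e.
by field.
Qed.

Lemma sum_arith_geom (x : R) K :
  (\sum_(j < K) j.+1%:R * x ^+ j.+1) * (1 - x) ^+ 2 =
  x * (1 - (K%:R + 1) * x ^+ K + K%:R * x ^+ K.+1).
Proof.
elim: K => [|K IH]; first by rewrite big_ord0 !expr0; ring.
by rewrite big_ord_recr/= mulrDl IH -[K.+1%:R]natr1 !exprS; ring.
Qed.

(* The derivative of the primitive below is the K-th partial sum of
   t^2/sinh^2 t = sum_j 4 j t^2 exp(-2jt), plus a bound on the remainder. *)
Lemma sqr_sinh_primitive r : 0 < r -> exists Q q : R -> R,
  [/\ forall t, is_derive t 1 Q (q t),
      forall t, 0 < t -> t ^+ 2 / sinh t ^+ 2 <= q t &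
      Q r - Q 0 < pi ^+ 2 / 6].
Proof.
(* This size makes 1/(2K) and 1/(2(K+1)), the boundary terms of the remainder at 0, each smaller
   than exp(-2r)/2, while Q(r) <= -exp(-2r): the part of the integral beyond r pays for the
   truncation and gives the strict inequality. *)
move=> r0; pose k := Num.Def.archi_bound (expR (2 * r)).
have kr : expR (2 * r) < k%:R by rewrite archi_boundP// expR_ge0.
pose K := k.+1.
have K0 : K%:R != 0 :> R by rewrite pnatr_eq0.
have K1 : K.+1%:R != 0 :> R by rewrite pnatr_eq0.
pose x t : R := expR (- (2 * t)).
(* A primitive of 4 (j+1) t^2 exp(-2(j+1)t), with value -1/(j+1)^2 at 0. *)
pose p (j : nat) t : R :=
  - (2 * t ^+ 2 + 2 * t / j.+1%:R + j.+1%:R ^- 2) * x t ^+ j.+1.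
pose Q t : R := \sum_(j < K) p j t + (- (x t ^+ K / (2 * K%:R)) - x t ^+ K / 2
  + K%:R * x t ^+ K.+1 / (2 * K.+1%:R)).
pose q t : R := \sum_(j < K) 4 * t ^+ 2 * (j.+1%:R * x t ^+ j.+1)
  + (x t ^+ K + K%:R * x t ^+ K - K%:R * x t ^+ K.+1).
have dx t : is_derive t 1 x (- 2 * x t) by rewrite /x; derive; ring.
have x0 t : 0 < x t by exact: expR_gt0.
have x1 t : 0 <= t -> x t <= 1 by move=> t0; rewrite /x -[leRHS]expR0 ler_expR; lra.
have xS t : 0 <= t -> x t ^+ K.+1 <= x t ^+ K.
  by move=> t0; rewrite exprS ler_piMl ?x1// exprn_ge0// ltW.
exists Q, q; split.
- move=> t; have hx := dx t; rewrite /Q /q; apply: is_derive_add.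
    apply: is_derive_bigsum => j; rewrite /p; derive.
    have : j.+1%:R != 0 :> R by rewrite pnatr_eq0.
    rewrite [x t ^+ j.+1]exprS /=; move: (x t ^+ j) (j.+1%:R : R) => X N N0.
    by field.
  derive; move: K0 K1; rewrite /K.
  rewrite /= ![x t ^+ k.+2]exprS ![x t ^+ k.+1]exprS.
  move: (k.+1%:R : R) (k.+2%:R : R) (x t ^+ k) => a b X a0 b0.
  by field; rewrite a0 b0.
- move=> t t0.
  have s0 : 0 < sinh t ^+ 2 by rewrite exprn_gt0// sinh_gt0.
  rewrite ler_pdivrMr//.
  have xt1 : 0 < (1 - x t) ^+ 2.
    by rewrite exprn_gt0// subr_gt0 /x -[ltRHS]expR0 ltr_expR; lra.
  have e := sinh2E t; rewrite /= -/(x t) in e.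
  have g := sum_arith_geom (x t) K.
  (* The remainder of the series is t^2 D/sinh^2 t, hence at most D because t <= sinh t. *)
  pose D := x t ^+ K + K%:R * x t ^+ K - K%:R * x t ^+ K.+1.
  have D0 : 0 <= D.
    rewrite /D -addrA -mulrBr addr_ge0 ?exprn_ge0 ?(ltW (x0 t))//.
    by rewrite mulr_ge0// subr_ge0 xS// ltW.
  have -> : q t = t ^+ 2 * (4 * \sum_(j < K) j.+1%:R * x t ^+ j.+1) + D.
    by rewrite /q -/D -mulr_sumr; ring.
  set A := \sum_(j < K) _ in g *.
  have hA : 4 * A * sinh t ^+ 2 = 1 - D.
    have : 4 * x t * (4 * A * sinh t ^+ 2) = 4 * x t * (1 - D).
      transitivity (4 * A * (4 * x t * sinh t ^+ 2)); first by ring.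
      rewrite e -mulrA g /D; ring.
    by apply: mulfI; rewrite mulf_neq0// gt_eqF.
  have -> : (t ^+ 2 * (4 * A) + D) * sinh t ^+ 2 =
      t ^+ 2 * (4 * A * sinh t ^+ 2) + D * sinh t ^+ 2 by ring.
  rewrite hA.
  have : t ^+ 2 <= sinh t ^+ 2.
    by rewrite ler_pXn2r// ?nnegrE ?le_sinh ?sinh_ge0// ltW.
  nra.
- have Qr : Q r <= - x r.
    have h1 : \sum_(j < K) p j r <= - x r.
      rewrite /K big_ord_recl/= -[leRHS]addr0 lerD//.
        rewrite /p expr1 mulNr lerN2 ler_peMl ?(ltW (x0 r))// expr1n invr1 mulr1.
        by rewrite lerDr addr_ge0// mulr_ge0// ?exprn_ge0// ltW.
      apply: sumr_le0 => j _; rewrite /p mulNr oppr_le0 mulr_ge0 ?exprn_ge0//.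
        by rewrite !addr_ge0 ?mulr_ge0 ?invr_ge0 ?exprn_ge0 ?(ltW r0).
      by rewrite ltW.
    have h2 : 0 <= x r ^+ K / (2 * K%:R).
      by rewrite divr_ge0 ?exprn_ge0 ?mulr_ge0// ltW.
    have h3 : K%:R * x r ^+ K.+1 / (2 * K.+1%:R) <= x r ^+ K / 2.
      have -> : K%:R * x r ^+ K.+1 / (2 * K.+1%:R) =
          (K%:R / K.+1%:R) * (x r ^+ K.+1 / 2).
        by rewrite mulf_div [K.+1%:R * 2]mulrC.
      rewrite (@le_trans _ _ (1 * (x r ^+ K.+1 / 2)))//.
        rewrite ler_wpM2r ?divr_ge0 ?exprn_ge0 ?(ltW (x0 r))//.
        by rewrite ler_pdivrMr ?ltr0n// mul1r ler_nat.
      by rewrite mul1r ler_wpM2r ?xS ?ltW.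
    rewrite /Q; move: h1 h2 h3.
    move: (\sum_(j < K) p j r) (x r ^+ K / (2 * K%:R)) (x r ^+ K / 2).
    by move: (K%:R * x r ^+ K.+1 / (2 * K.+1%:R)) => a b c d; lra.
  have x00 : x 0 = 1 by rewrite /x mulr0 oppr0 expR0.
  have Q0 : Q 0 = - \sum_(j < K) j.+1%:R ^- 2 - (2 * K%:R)^-1 - (2 * K.+1%:R)^-1.
    rewrite /Q x00 !expr1n -sumrN.
    under eq_bigr do rewrite /p x00 expr1n expr0n/= !mulr0 !mul0r !add0r mulr1.
    rewrite -!addrA; congr (_ + _); rewrite -[K.+1%:R]natr1 in K1 *.
    move: (K%:R : R) K0 K1 => a a0 a1; field.
    by rewrite a0 a1.
  have hb := sum_inv_sqr_le R K.
  have k0 : 0 < expR (2 * r) by exact: expR_gt0.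
  have xr : (x r)^-1 = expR (2 * r) by rewrite /x expRN invrK.
  have hK (j : nat) : (k <= j)%N -> (2 * j%:R)^-1 < x r / 2.
    move=> kj; have j0 : expR (2 * r) < j%:R by rewrite (lt_le_trans kr)// ler_nat.
    rewrite invfM mulrC ltr_pM2r ?invr_gt0// -[x r]invrK xr ltf_pV2// posrE//.
    exact: lt_trans j0.
  have := hK K (leqnSn k); have := hK K.+1 (leq_trans (leqnSn k) (leqnSn _)).
  rewrite Q0; move: hb Qr.
  move: (\sum_(j < K) _) ((2 * K%:R)^-1) ((2 * K.+1%:R)^-1) (x r) (Q r).
  by move: (pi ^+ 2 / 6) => P a b c d e; lra.
Qed.

End Hyperbolic.

(** * Shooting and Picone's identity *)

Lemma continuous_le_right (R : realType) (f : R -> R) (r C : R) : 0 < r ->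
  {for 0, continuous f} -> (forall t, 0 < t < r -> f t <= C) -> f 0 <= C.
Proof.
move=> r0 cf fC; rewrite leNgt; apply/negP => Cf.
have /nbhs_ballP[d /= d0 hd] : \forall t \near 0, C < f t.
  exact: (cvgr_gt (f 0) cf).
pose t := Num.min (d / 2) (r / 2).
have t0 : 0 < t by rewrite lt_min !divr_gt0.
have td : t <= d / 2 by rewrite ge_min lexx.
have tr : t <= r / 2 by rewrite ge_min lexx orbT.
have := hd t; rewrite /ball/= sub0r normrN gtr0_norm// => h.
have : C < f t by apply: h; lra.
by rewrite ltNge fC// t0/=; lra.
Qed.

Section Shooting.
Variables (R : realType) (nu : R).
Hypothesis nu1 : 1 <= nu.
Implicit Types (lam X : R).

(* The energy times a high power of X^2+2X is nondecreasing, so that a double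
   zero forces the derivative to vanish all the way down to 0. *)
Lemma radial_no_double_zero lam X0 : 0 <= lam -> 0 < X0 ->
  radial nu lam X0 = 0 -> radial1 nu lam X0 <> 0.
Proof.
move=> lam0 X00 F0 F10; have nu_ge1 := nu1.
(* The equation gives e' = -(2 nu - 1) D' F1^2, which is damping; a weight D^(k+1) with k > 2 nu
   outgrows it. *)
pose k := Num.Def.archi_bound (2 * nu).
have kb : 2 * nu < k%:R by rewrite archi_boundP//; lra.
pose D X := X ^+ 2 + 2 * X.
pose F X := radial nu lam X; pose F1 X := radial1 nu lam X.
pose e X := D X * F1 X ^+ 2 + lam * F X ^+ 2.
pose J X := D X ^+ k.+1 * e X.
have D0 X : 0 < X -> 0 < D X by move=> X1; rewrite /D; nra.
have J0 Y : 0 < Y -> Y < X0 -> J Y <= 0.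
  move=> Y0 YX.
  have -> : 0 = J X0.
    by rewrite /J /e [F _]F0 [F1 _]F10 expr0n/= !mulr0 addr0 mulr0.
  apply: (@le_of_derive_ge0 _ J (fun X => D X ^+ k * (2 * X + 2) *
     (k.+1%:R * e X - (2 * nu - 1) * (D X * F1 X ^+ 2)))); first exact: ltW.
  - move=> X /andP[YX1 _]; have X1 : -1 < X by lra.
    have hF := is_derive_radial nu1 lam X1.
    have hF1 := is_derive_radial1 nu1 lam X1.
    have o := radial_ode nu1 lam X1.
    rewrite /J /e /D /F /F1; derive.
    rewrite /= -/(D X) [D X ^+ k.+1]exprS; move: o.
    move: (radial2 _ _ _) (radial1 _ _ _) (radial _ _ _) => f2 f1 f o.
    move: (D X ^+ k) => P.
    have z : 2 * f1 * P * D X *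
      ((X ^+ 2 + 2 * X) * f2 + 2 * nu * (X + 1) * f1 + lam * f) = 0.
      by rewrite o mulr0.
    rewrite -[RHS]addr0 -[X in _ = _ + X]z /D; ring.
  - move=> X /andP[YX1 _]; have X1 : 0 < X by lra.
    have DX := D0 X X1.
    rewrite mulr_ge0 ?mulr_ge0 ?exprn_ge0 ?(ltW DX)//; first lra.
    have h1 : 0 <= D X * F1 X ^+ 2 by rewrite mulr_ge0 ?sqr_ge0// ltW.
    have h2 : 0 <= lam * F X ^+ 2 by rewrite mulr_ge0 ?sqr_ge0.
    rewrite /e -[k.+1%:R]natr1; move: h1 h2 kb.
    by move: (D X * _) (lam * _) (k%:R : R) => a b c; nra.
have F1Y Y : 0 < Y < X0 -> F1 Y = 0.
  move=> /andP[Y0 YX]; have DY := D0 Y Y0.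
  have := J0 Y Y0 YX; rewrite /J pmulr_rle0 ?exprn_gt0// /e => h.
  have h2 : 0 <= lam * F Y ^+ 2 by rewrite mulr_ge0 ?sqr_ge0.
  have : D Y * F1 Y ^+ 2 <= 0 by lra.
  rewrite pmulr_rle0// => h3; apply/eqP; rewrite -sqrf_eq0.
  by rewrite eq_le h3 sqr_ge0.
have : F 0 <= F X0.
  apply: (@le_of_derive_ge0 _ F F1 0 X0); first exact: ltW.
    by move=> X /andP[X0' _]; apply: is_derive_radial => //; lra.
  by move=> X /F1Y ->.
by rewrite /F radial_at0 F0 ler10.
Qed.

Lemma radial_continuous lam X : -1 < X -> {for X, continuous (radial nu lam)}.
Proof. by move=> /(is_derive_radial nu1 lam); exact: derive_continuous. Qed.

(** Let l be the supremum of the eigenvalues for which F is positive on [0, M]. By Lipschitz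
    dependence F >= 0 at l. A zero inside (0, M) would be a minimum, hence a double zero, which is
    excluded; without any zero, positivity would persist beyond l. So F vanishes exactly at M. *)
Lemma radial_shooting lam0 M : 0 < M -> 0 <= lam0 ->
  (exists2 X, 0 <= X <= M & radial nu lam0 X <= 0) ->
  exists2 lam, 0 <= lam <= lam0 &
    radial nu lam M = 0 /\ forall X, 0 <= X < M -> 0 < radial nu lam X.
Proof.
move=> M0 lam00 [Xb XbM Fb].
have [C C0 lip0] := le_radial_diff nu1 lam00 (ltW M0).
have lip a b X : 0 <= a <= lam0 -> 0 <= b <= lam0 -> 0 <= X <= M -> a <= b ->
    - ((b - a) * C) <= radial nu a X - radial nu b X <= (b - a) * C.
  move=> ha hb hX ab; rewrite -ler_norml.
  by have := lip0 a b X ha hb hX; rewrite [`|a - b|]distrC [`|b - a|]ger0_norm ?subr_ge0.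
pose S := [set l : R | 0 <= l <= lam0 /\ forall X, 0 <= X <= M -> 0 < radial nu l X].
have S0 : S 0.
  split=> [|X /andP[X0 _]]; first by rewrite lexx.
  by rewrite (radial_eigen0 nu1)//; lra.
have ubS : ubound S lam0 by move=> l [/andP[]].
have hS : has_sup S by split; [exists 0|exists lam0].
pose l := sup S.
have l0 : 0 <= l by apply: ub_le_sup => //; exists lam0.
have ll0 : l <= lam0 by apply: ge_sup => //; exists 0.
have lin : 0 <= l <= lam0 by rewrite l0.
have C1 : 0 < C + 1 by lra.
have Fge X : 0 <= X <= M -> 0 <= radial nu l X.
  move=> XM; rewrite leNgt; apply/negP => Fl.
  have d0 : 0 < - radial nu l X / (C + 1) by rewrite divr_gt0// oppr_gt0.
  have [l' [l'in Sl'] ll'] := sup_adherent d0 hS.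
  have l'l : l' <= l by apply: ub_le_sup => //; exists lam0.
  have /andP[_ h] := lip l' l X l'in lin XM l'l.
  have := Sl' X XM; rewrite -/l in ll'.
  have : (l - l') * (C + 1) <= - radial nu l X by rewrite -ler_pdivlMr//; lra.
  move: (radial nu l' X) (radial nu l X) h => a b; nra.
have Fz X1 : 0 <= X1 <= M -> radial nu l X1 = 0 -> X1 = M.
  move=> X1M FX1; apply/eqP; rewrite eq_le.
  have [X10 X1le] := andP X1M; rewrite X1le/= leNgt.
  apply/negP => X1lt.
  have X1gt : 0 < X1.
    rewrite lt_neqAle X10 andbT; apply/eqP => e.
    by have := radial_at0 nu l; rewrite e FX1 => /eqP; rewrite eq_sym oner_eq0.
  apply: (radial_no_double_zero l0 X1gt FX1).
  have hd : is_derive X1 1 (radial nu l) (radial1 nu l X1).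
    by apply: is_derive_radial => //; lra.
  have [_ <-] := hd.
  suff [_ ->] : is_derive X1 1 (radial nu l) 0 by [].
  apply: (@derive1_at_min R (radial nu l) 0 M) => [|t|/=|t].
  - exact: ltW.
  - rewrite in_itv/= => /andP[t0 _].
    by have [] : is_derive t 1 (radial nu l) (radial1 nu l t);
      first by apply: is_derive_radial => //; lra.
  - by rewrite in_itv/= X1gt.
  - by rewrite in_itv/= => /andP[t0 tM]; rewrite FX1 Fge// !ltW.
have [X1 X1M FX1] : exists2 X, 0 <= X <= M & radial nu l X = 0.
  apply: contrapT => nz.
  have pos X : 0 <= X <= M -> 0 < radial nu l X.
    move=> XM; rewrite lt_neqAle Fge// andbT; apply/eqP => e.
    by apply: nz; exists X.
  have cont : {within `[0, M], continuous (radial nu l)}.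
    apply: continuous_in_subspaceT => y /[!inE]/=.
    by rewrite in_itv/= => /andP[y0 _]; apply: radial_continuous; lra.
  have [c /[!in_itv]/= cM hc] := EVT_min (ltW M0) cont.
  have llt : l < lam0.
    rewrite lt_neqAle ll0 andbT; apply/eqP => e.
    by have := pos _ XbM; rewrite e ltNge Fb.
  have e0 := pos c cM.
  (* This step costs at most half of the minimum of F at l; the divisor C + 1 is positive even if C
     = 0. *)
  pose l' := Num.min lam0 (l + radial nu l c / (C + 1) / 2).
  have q0 : 0 < radial nu l c / (C + 1) by rewrite divr_gt0.
  have l'gt : l < l' by rewrite lt_min llt; lra.
  have l'in : 0 <= l' <= lam0 by rewrite (le_trans l0 (ltW l'gt)) ge_min lexx.
  suff : S l' by move=> /(ub_le_sup (ex_intro _ _ ubS)); rewrite -/l leNgt l'gt.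
  split=> // X XM.
  have /andP[_ h] := lip l l' X lin l'in XM (ltW l'gt).
  have hc' : radial nu l c <= radial nu l X by apply: hc; rewrite in_itv.
  have l'le : l' <= l + radial nu l c / (C + 1) / 2 by rewrite ge_min lexx orbT.
  have : (l' - l) * (C + 1) <= radial nu l c / 2.
    by rewrite -ler_pdivlMr// mulrAC; lra.
  move: (radial nu l' X) (radial nu l X) (radial nu l c) h hc' e0 => a b d; nra.
have [lz zM] := (Fz _ X1M FX1, FX1).
exists l => //; split; first by rewrite -lz.
move=> X /andP[X0 XM]; have XM' : 0 <= X <= M by rewrite X0 ltW.
rewrite lt_neqAle Fge// andbT; apply/eqP => e.
by have := Fz X XM' (esym e) => e'; rewrite e' ltxx in XM.
Qed.

End Shooting.

(** * The radial function of the distance t *)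

Definition polar (R : realType) (nu lam t : R) : R := radial nu lam (cosh t - 1).

Definition polar1 (R : realType) (nu lam t : R) : R :=
  radial1 nu lam (cosh t - 1) * sinh t.

Definition polar2 (R : realType) (nu lam t : R) : R :=
  radial2 nu lam (cosh t - 1) * sinh t ^+ 2 + radial1 nu lam (cosh t - 1) * cosh t.

Section Polar.
Variables (R : realType) (nu lam : R).
Hypothesis nu1 : 1 <= nu.

Let cosh_sub1_gtN1 (t : R) : -1 < cosh t - 1.
Proof. by have := cosh_gt0 t; lra. Qed.

Lemma is_derive_polar (t : R) : is_derive t 1 (polar nu lam) (polar1 nu lam t).
Proof.
have hF := is_derive_radial nu1 lam (cosh_sub1_gtN1 t); have hc := is_derive_cosh t.
by rewrite /polar /polar1; derive; ring.
Qed.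

Lemma is_derive_polar1 (t : R) : is_derive t 1 (polar1 nu lam) (polar2 nu lam t).
Proof.
have hF := is_derive_radial1 nu1 lam (cosh_sub1_gtN1 t); have hc := is_derive_cosh t.
by have hs := is_derive_sinh t; rewrite /polar1 /polar2; derive; ring.
Qed.

(** Multiplied by sinh t, the equation also makes sense at t = 0. *)
Lemma polar_ode (t : R) : sinh t * polar2 nu lam t +
  (2 * nu - 1) * cosh t * polar1 nu lam t + lam * sinh t * polar nu lam t = 0.
Proof.
have := radial_ode nu1 lam (cosh_sub1_gtN1 t); have := cosh2_sinh2 t.
rewrite /polar2 /polar1 /polar; move: (radial2 _ _ _) (radial1 _ _ _) (radial _ _ _).
move=> f2 f1 f hc ho.
transitivity (sinh t * ((cosh t ^+ 2 - 1) * f2 + 2 * nu * cosh t * f1 + lam * f)).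
  by rewrite hc; ring.
by rewrite -[RHS](mulr0 (sinh t)) -ho; congr (_ * _); ring.
Qed.

End Polar.

Section Picone.
Variables (R : realType) (s r : R).
Hypotheses (s1 : 1 <= s) (r0 : 0 < r).

(* Picone's identity for f(t) = sin(kt) and the solution sinh^s t g(t), where
   psi = s coth + g'/g is its logarithmic derivative. *)
Lemma rayleigh_bound (lam : R) (Q q : R -> R) :
  (forall t : R, is_derive t 1 Q (q t)) ->
  (forall t : R, 0 < t -> t ^+ 2 / sinh t ^+ 2 <= q t) ->
  (forall X : R, 0 <= X <= cosh r - 1 -> 0 < radial (s + 2^-1) lam X) ->
  (lam - s ^+ 2 - (pi / r) ^+ 2) * (r / 2) <=
     s * (s - 1) * (pi / r) ^+ 2 * (Q r - Q 0).
Proof.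
move=> dQ hq pos.
have s_ge1 := s1.
have nu1 : 1 <= s + 2^-1 by lra.
pose k : R := pi / r.
have kr : k * r = pi by rewrite /k divfK// gt_eqF.
pose g := polar (s + 2^-1) lam.
pose g1 := polar1 (s + 2^-1) lam.
pose g2 := polar2 (s + 2^-1) lam.
have dg : forall t : R, is_derive t 1 g (g1 t) := is_derive_polar lam nu1.
have dg1 : forall t : R, is_derive t 1 g1 (g2 t) := is_derive_polar1 lam nu1.
have ode (t : R) : sinh t * g2 t + 2 * s * cosh t * g1 t + lam * sinh t * g t = 0.
  by rewrite -(polar_ode lam nu1 t) -/g -/g1 -/g2; field.
have gpos (t : R) : 0 <= t <= r -> 0 < g t.
  move=> /andP[t0 tr]; apply: pos.
  have := cosh_ge1 t; rewrite subr_ge0 => ->/=; rewrite lerD2r.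
  apply: (@le_of_derive_ge0 _ (@cosh R) (@sinh R)) => //.
    by move=> x _; exact: is_derive_cosh.
  by move=> x /andP[tx _]; rewrite sinh_ge0// ltW// (le_lt_trans t0).
pose c := s * (s - 1); pose E := lam - s ^+ 2 - k ^+ 2.
have c0 : 0 <= c by rewrite /c; nra.
have k0 : 0 < k by rewrite divr_gt0// pi_gt0.
have Eq : E = lam - s ^+ 2 - k ^+ 2 by [].
have cq : c = s * (s - 1) by [].
have -> : pi / r = k by [].
clearbody k E c.
pose psi t : R := s * (cosh t / sinh t) + g1 t / g t.
(* The Riccati equation psi' = V - psi^2, where V = c/sinh^2 + s^2 - lam and s^2 - lam = - E -
   k^2. *)
have dpsi (t : R) : 0 < t <= r ->
    is_derive t 1 psi (c / sinh t ^+ 2 - E - k ^+ 2 - psi t ^+ 2).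
  move=> /andP[t0 tr]; have gt0 : 0 < g t by rewrite gpos// ltW.
  have sh0 := sinh_gt0 t0; have hdg := dg t; have hdg1 := dg1 t.
  have hc := is_derive_cosh t; have hs := is_derive_sinh t.
  have sn : sinh t != 0 by rewrite gt_eqF.
  have gn : g t != 0 by rewrite gt_eqF.
  rewrite /psi; derive => //.
  have -> : g2 t = - 2 * s * (cosh t / sinh t) * g1 t - lam * g t.
    apply: (mulfI sn); apply/eqP; rewrite -subr_eq0 -(ode t); apply/eqP.
    by field.
  rewrite Eq cq; have := cosh2_sinh2 t.
  move: (cosh t) (sinh t) (g1 t) (g t) sn gn => C S G1 G sn gn hCS.
  apply/eqP; rewrite -subr_eq0; apply/eqP.
  transitivity ((s ^+ 2 - s) / S ^+ 2 * (C ^+ 2 - S ^+ 2 - 1)).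
    by field; rewrite sn gn.
  by rewrite hCS; ring.
(* A primitive of (k cos(kt) - sin(kt) psi)^2 + c (k^2 q - sin^2(kt)/sinh^2 t), both terms of which
   are nonnegative; the factor of E is the primitive of sin^2(kt). At r only - E r/2 + c k^2 Q(r)
   survives. *)
pose H t : R := k * (sin (k * t) * cos (k * t)) - sin (k * t) ^+ 2 * psi t
  - E * (t / 2 - sin (k * t) * cos (k * t) / (2 * k)) + c * k ^+ 2 * Q t.
have sin_kt (t : R) : 0 <= t <= r -> 0 <= sin (k * t).
  move=> /andP[t0 tr]; apply: sin_ge0_pi; rewrite mulr_ge0 ?(ltW k0)//=.
  by rewrite -kr ler_wpM2l// ltW.
have sin2 (t : R) : 0 <= t <= r -> sin (k * t) ^+ 2 <= k ^+ 2 * t ^+ 2.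
  move=> tr; have [t0 _] := andP tr; have kt0 : 0 <= k * t by rewrite mulr_ge0// ltW.
  by rewrite -exprMn ler_pXn2r ?nnegrE ?sin_kt// sin_le.
have Hincr (t : R) : 0 < t <= r -> H t <= H r.
  move=> /andP[t0 tr].
  pose h x : R := (k * cos (k * x) - sin (k * x) * psi x) ^+ 2
    + c * (k ^+ 2 * q x - sin (k * x) ^+ 2 / sinh x ^+ 2).
  apply: (@le_of_derive_ge0 R H h t r tr).
  - move=> x /andP[tx xr]; have x0 := lt_le_trans t0 tx.
    have hp : is_derive x 1 psi (c / sinh x ^+ 2 - E - k ^+ 2 - psi x ^+ 2).
      by apply: dpsi; rewrite x0.
    have hq' := dQ x; rewrite /H /h; derive.
    have sn : sinh x != 0 by rewrite gt_eqF// sinh_gt0.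
    have kn : k != 0 by rewrite gt_eqF.
    have := cos2Dsin2 (k * x); rewrite /=.
    move: (cos _) (sin _) (psi x) (q x) (sinh x) sn => Co Si P qx S sn hcs.
    apply/eqP; rewrite -subr_eq0; apply/eqP.
    transitivity (E / 2 * (Co ^+ 2 + Si ^+ 2 - 1)).
      by field; rewrite sn kn.
    by rewrite hcs subrr mulr0.
  - move=> x /andP[tx xr]; have x0 := lt_trans t0 tx.
    rewrite /h addr_ge0 ?sqr_ge0// mulr_ge0// subr_ge0.
    have S2 : 0 < sinh x ^+ 2 by rewrite exprn_gt0// sinh_gt0.
    rewrite (@le_trans _ _ (k ^+ 2 * (x ^+ 2 / sinh x ^+ 2)))//; last first.
      by rewrite ler_wpM2l ?sqr_ge0// hq.
    by rewrite mulrA ler_wpM2r ?invr_ge0 ?(ltW S2)// sin2// !ltW.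
(* psi is singular at 0. Its part s coth t, weighted by sin^2(kt), is replaced by the larger k^2 s t
   cosh t, so that H1 lies below H and is continuous at 0 with value c k^2 Q(0). *)
pose H1 t : R := k * (sin (k * t) * cos (k * t)) - sin (k * t) ^+ 2 * (g1 t / g t)
  - E * (t / 2 - sin (k * t) * cos (k * t) / (2 * k)) + c * k ^+ 2 * Q t
  - k ^+ 2 * s * (t * cosh t).
have H1H (t : R) : 0 < t < r -> H1 t <= H r.
  move=> /andP[t0 tr]; have HH : H t <= H r by apply: Hincr; rewrite t0 ltW.
  apply: le_trans HH.
  have sh0 := sinh_gt0 t0.
  have : sin (k * t) ^+ 2 * (s * (cosh t / sinh t)) <= k ^+ 2 * s * (t * cosh t).
    rewrite mulrA mulrA ler_pdivrMr//.
    have -> : k ^+ 2 * s * (t * cosh t) * sinh t = k ^+ 2 * (t * sinh t) * s * cosh t.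
      by ring.
    rewrite ler_wpM2r ?(ltW (cosh_gt0 t))// ler_wpM2r//; first lra.
    rewrite (le_trans (sin2 _ _)) ?(ltW t0) ?(ltW tr)// ler_wpM2l ?sqr_ge0//.
    by rewrite expr2 ler_wpM2l ?le_sinh// ltW.
  rewrite /H1 /H /psi mulrDr; lra.
have cH1 : {for 0, continuous H1}.
  have [d hd] : exists d, is_derive (0 : R) 1 H1 d.
    have hg := dg 0; have hg1 := dg1 0; have hQ := dQ 0; have hc := is_derive_cosh (0 : R).
    have g00 : g 0 != 0 by rewrite gt_eqF// gpos// lexx ltW.
    by eexists; rewrite /H1; derive; last reflexivity.
  exact: derive_continuous hd.
rewrite -Eq -cq; have := continuous_le_right r0 cH1 H1H.
rewrite /H1 /H kr !mulr0 sin0 sinpi !mul0r !mulr0 expr0n/= !mul0r !subr0 !add0r.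
by move: (Q r) (Q 0) (k ^+ 2) => a b d; nra.
Qed.

End Picone.

(** * Eigenfunctions on the interval *)

Section IntervalEigenvalue.
Variables (R : realType) (s r : R).
Hypotheses (s1 : 1 <= s) (r0 : 0 < r).

Lemma cosh_sub1_gt0 (t : R) : 0 < t -> 0 < cosh t - 1.
Proof.
move=> t0; rewrite subr_gt0 -(@ltr_pXn2r _ 2)// ?nnegrE ?(ltW (cosh_gt0 t))//.
by rewrite cosh2_sinh2 expr1n ltrDr exprn_gt0// sinh_gt0.
Qed.

Lemma ltr_cosh (a b : R) : 0 <= a -> a < b -> cosh a < cosh b.
Proof.
move=> a0 ab; rewrite -subr_gt0.
have -> : cosh b - cosh a = (expR b - expR a) * (1 - expR (- (a + b))) / 2.
  have ea : expR a * expR (- a) = 1 by rewrite -expRD subrr expR0.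
  have eb : expR b * expR (- b) = 1 by rewrite -expRD subrr expR0.
  rewrite /cosh opprD expRD.
  transitivity ((expR b + expR (- b) * (expR a * expR (- a)) -
     expR a - expR (- a) * (expR b * expR (- b))) / 2); last by field.
  by rewrite ea eb; field.
rewrite divr_gt0// mulr_gt0// subr_gt0 ?ltr_expR// -[ltRHS]expR0 ltr_expR; lra.
Qed.

(** Strictness has two sources: room left in B, or s > 1, when the strict bound on Q(r) - Q(0)
    survives multiplication by s(s-1). *)
Lemma radial_eigenvalue (B : R) :
  (pi / r) ^+ 2 + s * (s - 1) * pi ^+ 4 / (3 * r ^+ 3) <= B ->
  (pi / r) ^+ 2 + s * (s - 1) * pi ^+ 4 / (3 * r ^+ 3) < B \/ 1 < s ->
  exists2 lam, lam < s ^+ 2 + B &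
    radial (s + 2^-1) lam (cosh r - 1) = 0 /\
    forall X, 0 <= X < cosh r - 1 -> 0 < radial (s + 2^-1) lam X.
Proof.
move=> bB strict; have s_ge1 := s1.
have nu1 : 1 <= s + 2^-1 by lra.
have [Q [q [dQ hq Qlt]]] := sqr_sinh_primitive r0.
pose k : R := pi / r.
have k0 : 0 < k by rewrite divr_gt0// pi_gt0.
have c0 : 0 <= s * (s - 1) by nra.
pose B1 : R := k ^+ 2 + 2 / r * (s * (s - 1) * k ^+ 2 * (Q r - Q 0)).
have k2 : 0 < 2 / r * k ^+ 2 by rewrite mulr_gt0 ?divr_gt0 ?exprn_gt0.
have bE : k ^+ 2 + s * (s - 1) * pi ^+ 4 / (3 * r ^+ 3) =
    k ^+ 2 + 2 / r * (s * (s - 1) * k ^+ 2 * (pi ^+ 2 / 6)).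
  by rewrite /k; move: (pi : R) => p; field; rewrite gt_eqF.
have B1B : B1 < B.
  rewrite -/k bE in bB strict.
  have e x : 2 / r * (s * (s - 1) * k ^+ 2 * x) = 2 / r * k ^+ 2 * (s * (s - 1)) * x.
    by ring.
  case: strict => [|ss1].
    apply: le_lt_trans; rewrite /B1 lerD2l !e ler_wpM2l ?(ltW Qlt)//.
    by rewrite mulr_ge0// ltW.
  apply: lt_le_trans bB; rewrite /B1 ltrD2l !e ltr_pM2l// mulr_gt0//.
  by rewrite mulr_gt0 ?subr_gt0//; lra.
have B0 : 0 < B.
  apply: lt_le_trans bB; rewrite ltr_pwDl ?exprn_gt0//.
  apply: divr_ge0; first by rewrite mulr_ge0// exprn_ge0// pi_ge0.
  by rewrite mulr_ge0// exprn_ge0// ltW.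
(* Strictly between the Rayleigh bound [B1], beyond which F cannot stay positive, and B; the maximum
   with 0 keeps s^2 + E0 nonnegative for the shooting. *)
pose E0 := (Num.max B1 0 + B) / 2.
have mB : Num.max B1 0 < B by rewrite gt_max B1B.
have B1m : B1 <= Num.max B1 0 by rewrite le_max lexx.
have m0 : 0 <= Num.max B1 0 by rewrite le_max lexx orbT.
have lam00 : 0 <= s ^+ 2 + E0 by rewrite addr_ge0 ?sqr_ge0// /E0; lra.
have [|lam lamE h] := radial_shooting nu1 (cosh_sub1_gt0 r0) lam00; last first.
  by exists lam => //; have /andP[_] := lamE; rewrite /E0; lra.
apply: contrapT => nex.
have pos X : 0 <= X <= cosh r - 1 -> 0 < radial (s + 2^-1) (s ^+ 2 + E0) X.
  by move=> hX; rewrite ltNge; apply/negP => h; apply: nex; exists X.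
have := rayleigh_bound s1 r0 dQ hq pos; rewrite -/k.
have -> : s ^+ 2 + E0 - s ^+ 2 - k ^+ 2 = E0 - k ^+ 2 by ring.
rewrite mulrA ler_pdivrMr// -ler_pdivlMr// => h.
have : E0 <= B1.
  by rewrite -subr_ge0 /B1; rewrite -subr_ge0 in h; apply: le_trans h _; rewrite le_eqVlt;
   apply/orP; left; apply/eqP; field; rewrite gt_eqF.
by rewrite /E0; lra.
Qed.

(** The factor sinh^s t removes the first-order term of the radial equation and leaves the potential
    s(s-1)/sinh^2 t + s^2. *)
Lemma interval_eigenvalue_polar (n : nat) (alpha lam : R) :
  s * (s - 1) = (n%:R - 1) * alpha / 4 ->
  radial (s + 2^-1) lam (cosh r - 1) = 0 ->
  (forall X, 0 <= X < cosh r - 1 -> 0 < radial (s + 2^-1) lam X) ->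
  interval_eigenvalue n r alpha ((n%:R - 1) ^+ 2 / 4 + (lam - s ^+ 2)).
Proof.
move=> hs zr pos; have s_ge1 := s1; have r_gt0 := r0.
have nu1 : 1 <= s + 2^-1 by lra.
pose g := polar (s + 2^-1) lam; pose g1 := polar1 (s + 2^-1) lam.
pose g2 := polar2 (s + 2^-1) lam.
have dg : forall t : R, is_derive t 1 g (g1 t) := is_derive_polar lam nu1.
have dg1 : forall t : R, is_derive t 1 g1 (g2 t) := is_derive_polar1 lam nu1.
have ode (t : R) : sinh t * g2 t + 2 * s * cosh t * g1 t + lam * sinh t * g t = 0.
  by rewrite -(polar_ode lam nu1 t) -/g -/g1 -/g2; field.
pose p (t : R) := sinh t `^ s.
have dp (t : R) : 0 < t -> is_derive t 1 p (s * (cosh t / sinh t) * p t).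
  move=> t0; have sh0 := sinh_gt0 t0.
  have hsh := is_derive_sinh t; have hp := is_derive1_powR s sh0.
  apply: is_derive_change (is_derive_chain hp hsh) _.
  rewrite powRB; last by rewrite (gt_eqF sh0) implybT.
  by rewrite powRr1 ?ltW// -/(p t); field; rewrite gt_eqF.
pose u t := p t * g t.
pose u1 t := p t * (s * (cosh t / sinh t) * g t + g1 t).
have du (t : R) : 0 < t -> is_derive t 1 u (u1 t).
  by move=> t0; have hp := dp t t0; have hg := dg t; rewrite /u /u1; derive; ring.
have du1 (t : R) : 0 < t -> is_derive t 1 u1
    (u t * (s * (s - 1) / sinh t ^+ 2 + s ^+ 2 - lam)).
  move=> t0; have hp := dp t t0; have hg := dg t; have hg1 := dg1 t.
  have hc := is_derive_cosh t; have hsh := is_derive_sinh t.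
  have sn : sinh t != 0 by rewrite gt_eqF// sinh_gt0.
  rewrite /u /u1; derive => //.
  have -> : g2 t = - 2 * s * (cosh t / sinh t) * g1 t - lam * g t.
    apply: (mulfI sn); apply/eqP; rewrite -subr_eq0 -(ode t); apply/eqP.
    by field.
  have := cosh2_sinh2 t.
  move: (cosh t) (sinh t) (g1 t) (g t) (p t) sn => C S G1 G P sn hCS.
  apply/eqP; rewrite -subr_eq0; apply/eqP.
  transitivity (P * G * (s ^+ 2 - s) / S ^+ 2 * (C ^+ 2 - S ^+ 2 - 1)).
    by field.
  by rewrite hCS; ring.
have near_pos (t : R) : 0 < t -> \forall x \near t, 0 < x.
  by move=> t0; exact: lt_nbhsr.
exists u; split.
- apply/(continuous_within_itvP _ r0); split.
  + by move=> t /[!in_itv]/=/andP[t0 _]; exact: derive_continuous (du t t0).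
  + have sinh_at0 : sinh t @[t --> (0 : R)^'+] --> (0 : R).
      rewrite -[X in _ --> X](@sinh0 R); apply: cvg_at_right_filter.
      exact: derive_continuous (is_derive_sinh 0).
    (* As s >= 1, near 0 one has 0 <= sinh^s t <= sinh t. *)
    have p_at0 : p t @[t --> (0 : R)^'+] --> (0 : R).
      apply: (squeeze_cvgr _ (cvg_cst 0) sinh_at0); near=> t.
      rewrite powR_ge0/= ge1r_powR// sinh_gt0//=.
      by near: t; exact: (cvgr_le 0 sinh_at0).
    rewrite /u {2}/p sinh0 powR0 ?gt_eqF//; last lra.
    apply: cvgM; first exact: p_at0.
    by apply: cvg_at_right_filter; exact: derive_continuous (dg 0).
  + by apply: cvg_at_left_filter; exact: derive_continuous (du r r0).
- by rewrite /u /p sinh0 powR0 ?mul0r// gt_eqF//; lra.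
- by rewrite /u /g /polar zr mulr0.
- exists (r / 2); first by rewrite in_itv/= divr_gt0//=; lra.
  rewrite mulf_neq0// gt_eqF//; first by rewrite powR_gt0// sinh_gt0// divr_gt0.
  apply: pos; rewrite ltW ?cosh_sub1_gt0 ?divr_gt0//= ltrD2r.
  by apply: ltr_cosh; rewrite ?divr_ge0 ?ltW//; lra.
move=> t /[!in_itv]/=/andP[t0 tr].
have e : \forall x \near t, derive1 u x = u1 x.
  near=> x; rewrite derive1E; have [//|_ ->//] := du x _.
  by near: x; exact: near_pos.
have [d2 e2] : is_derive t 1 (derive1 u) (u t * (s * (s - 1) / sinh t ^+ 2 + s ^+ 2 - lam)).
  by apply: near_eq_is_derive (du1 t t0); near do apply/esym.
split; [by case: (du t t0)|exact: d2|].
rewrite derive1E e2 /potential hs.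
by field; rewrite gt_eqF// sinh_gt0.
Unshelve. all: by end_near. Qed.

End IntervalEigenvalue.

(** * Second order jets and the hyperbolic Laplacian *)

(** A function with candidate formulas for its first and second partial derivatives; [jhess J i j]
    differentiates [jgrad J i] in direction j. The Laplacian of a composite expression thus becomes
    an algebraic identity. *)
Record jet (R : realType) (d : nat) := Jet {
  jval : 'rV[R]_d -> R;
  jgrad : 'I_d -> 'rV[R]_d -> R;
  jhess : 'I_d -> 'I_d -> 'rV[R]_d -> R }.

Section Jets.
Variables (R : realType) (d : nat).
Implicit Types (J K : jet R d) (H : set 'rV[R]_d) (x : 'rV[R]_d) (i j : 'I_d).

Definition jet_on H J : Prop := forall x, H x ->
  [/\ {for x, continuous (jval J)},
      forall i, is_derive x (delta_mx 0 i) (jval J) (jgrad J i x) /\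
        {for x, continuous (jgrad J i)} &
      forall i j, is_derive x (delta_mx 0 j) (jgrad J i) (jhess J i j x) /\
        {for x, continuous (jhess J i j)}].

Definition jet_const (c : R) : jet R d :=
  Jet (fun=> c) (fun _ _ => 0) (fun _ _ _ => 0).

Definition jet_coord (k : 'I_d) : jet R d :=
  Jet (fun x => x 0 k) (fun i _ => (k == i)%:R) (fun _ _ _ => 0).

Definition jet_add J K : jet R d :=
  Jet (fun x => jval J x + jval K x) (fun i x => jgrad J i x + jgrad K i x)
      (fun i j x => jhess J i j x + jhess K i j x).

Definition jet_mul J K : jet R d :=
  Jet (fun x => jval J x * jval K x)
      (fun i x => jgrad J i x * jval K x + jval J x * jgrad K i x)
      (fun i j x => jhess J i j x * jval K x + jgrad J i x * jgrad K j x +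
                    (jgrad J j x * jgrad K i x + jval J x * jhess K i j x)).

Definition jet_comp (f f1 f2 : R -> R) J : jet R d :=
  Jet (fun x => f (jval J x)) (fun i x => f1 (jval J x) * jgrad J i x)
      (fun i j x => f2 (jval J x) * jgrad J j x * jgrad J i x +
                    f1 (jval J x) * jhess J i j x).

Definition jet_sum (n : nat) (Js : 'I_n -> jet R d) : jet R d :=
  Jet (fun x => \sum_k jval (Js k) x) (fun i x => \sum_k jgrad (Js k) i x)
      (fun i j x => \sum_k jhess (Js k) i j x).

Lemma jet_on_const H c : jet_on H (jet_const c).
Proof.
move=> x _; split=> [|i|i j] /=; first exact: cst_continuous.
  by split; [exact: is_derive_const|exact: cst_continuous].
by split; [exact: is_derive_const|exact: cst_continuous].
Qed.

Lemma is_derive_coord x (v : 'rV[R]_d) (k : 'I_d) :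
  is_derive x v (fun y => y 0 k) (v 0 k).
Proof.
apply/is_derive_along.
have -> : (fun h : R => (h *: v + x) 0 k) = (fun h => h * v 0 k + x 0 k).
  by apply/funext => h; rewrite !mxE.
by derive; ring.
Qed.

Lemma jet_on_coord H (k : 'I_d) : jet_on H (jet_coord k).
Proof.
move=> x _; split=> [|i|i j] /=; first exact: coord_continuous.
  split; last exact: cst_continuous.
  have := is_derive_coord x (delta_mx 0 i) k.
  by rewrite mxE eqxx/= => h; exact: h.
by split; [exact: is_derive_const|exact: cst_continuous].
Qed.

Lemma jet_on_add H J K : jet_on H J -> jet_on H K -> jet_on H (jet_add J K).
Proof.
move=> hJ hK x Hx; have [cJ gJ dJ] := hJ x Hx; have [cK gK dK] := hK x Hx.
split=> [|i|i j] /=.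
- exact: continuousD.
- by have [? ?] := gJ i; have [? ?] := gK i; split; [exact: is_derive_add|exact: continuousD].
- by have [? ?] := dJ i j; have [? ?] := dK i j; split; [exact: is_derive_add|exact: continuousD].
Qed.

Lemma jet_on_mul H J K : jet_on H J -> jet_on H K -> jet_on H (jet_mul J K).
Proof.
move=> hJ hK x Hx; have [cJ gJ dJ] := hJ x Hx; have [cK gK dK] := hK x Hx.
split=> [|i|i j] /=; first exact: continuousM.
  have [dJi cJi] := gJ i; have [dKi cKi] := gK i.
  by split; [exact: is_derive_mul|apply: continuousD; exact: continuousM].
have [dJi cJi] := gJ i; have [dKi cKi] := gK i.
have [dJj cJj] := gJ j; have [dKj cKj] := gK j.
have [dJij cJij] := dJ i j; have [dKij cKij] := dK i j.
split; last by apply: continuousD; apply: continuousD; exact: continuousM.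
by apply: is_derive_add; exact: is_derive_mul.
Qed.

Lemma jet_on_comp H (f f1 f2 : R -> R) J : jet_on H J ->
  (forall x, H x -> [/\ is_derive (jval J x) 1 f (f1 (jval J x)),
     is_derive (jval J x) 1 f1 (f2 (jval J x)) & {for jval J x, continuous f2}]) ->
  jet_on H (jet_comp f f1 f2 J).
Proof.
move=> hJ hf x Hx; have [cJ gJ dJ] := hJ x Hx; have [df df1 cf2] := hf x Hx.
have cf1 := derive_continuous df1.
have c1 : {for x, continuous (fun y => f1 (jval J y))} by exact: continuous_comp.
have c2 : {for x, continuous (fun y => f2 (jval J y))} by exact: continuous_comp.
split=> [|i|i j] /=.
- by apply: continuous_comp => //; exact: derive_continuous df.
- by have [? ?] := gJ i; split; [exact: is_derive_chain|exact: continuousM].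
- have [dJi cJi] := gJ i; have [dJj cJj] := gJ j; have [dJij cJij] := dJ i j.
  split; last by apply: continuousD; apply: continuousM => //; exact: continuousM.
  by apply: is_derive_mul => //; exact: is_derive_chain.
Qed.

Lemma continuous_bigsum (n : nat) (f : 'I_n -> 'rV[R]_d -> R) x :
  (forall k, {for x, continuous (f k)}) ->
  {for x, continuous (fun y => \sum_k f k y)}.
Proof.
move=> h; have -> : (fun y => \sum_k f k y) = \sum_k f k.
  by apply/funext => y; rewrite fct_sumE.
elim/big_ind: _ => [|g1 g2 c1 c2|k _]; [exact: cst_continuous|exact: continuousD|exact: h].
Qed.

Lemma jet_on_sum H (n : nat) (Js : 'I_n -> jet R d) :
  (forall k, jet_on H (Js k)) -> jet_on H (jet_sum Js).
Proof.
move=> h x Hx; split=> [|i|i j] /=.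
- by apply: continuous_bigsum => k; have [] := h k x Hx.
- split; last by apply: continuous_bigsum => k; have [_ /(_ i)[]] := h k x Hx.
  by apply: is_derive_bigsum => k; have [_ /(_ i)[]] := h k x Hx.
- split; last by apply: continuous_bigsum => k; have [_ _ /(_ i j)[]] := h k x Hx.
  by apply: is_derive_bigsum => k; have [_ _ /(_ i j)[]] := h k x Hx.
Qed.

Lemma partial_jet H J i x : jet_on H J -> H x -> partial i (jval J) x = jgrad J i x.
Proof. by move=> hJ Hx; have [_ /(_ i)[[_ h] _] _] := hJ x Hx; exact: h. Qed.

(** Differentiating [partial i] again requires its formula on a neighbourhood, whence the openness
    of H. *)
Lemma near_partial_jet H J i x : open H -> jet_on H J -> H x ->
  \forall y \near x, jgrad J i y = partial i (jval J) y.
Proof.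
move=> oH hJ Hx; have : \forall y \near x, H y by exact: open_nbhs_nbhs.
by apply: filterS => y Hy; rewrite (partial_jet i hJ Hy).
Qed.

Lemma is_derive_partial_jet H J i j x : open H -> jet_on H J -> H x ->
  is_derive x (delta_mx 0 j) (partial i (jval J)) (jhess J i j x).
Proof.
move=> oH hJ Hx; have [_ _ /(_ i j)[h _]] := hJ x Hx.
exact: near_eq_is_derive (near_partial_jet i oH hJ Hx) h.
Qed.

Lemma near_eq_continuous (f g : 'rV[R]_d -> R) x :
  (\forall y \near x, f y = g y) -> {for x, continuous f} -> {for x, continuous g}.
Proof.
move=> e c; have ex := nbhs_singleton e.
rewrite /prop_for /continuous_at -ex; apply: cvg_trans c.
exact: near_eq_cvg e.
Qed.

Lemma jet_C2_on H J : open H -> jet_on H J -> C2_on H (jval J).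
Proof.
move=> oH hJ x Hx; have [cJ gJ dJ] := hJ x Hx; split=> // i.
split.
- by have [[]] := gJ i.
- have [_ c] := gJ i; exact: near_eq_continuous (near_partial_jet i oH hJ Hx) c.
- move=> j; have h := is_derive_partial_jet i j oH hJ Hx.
  split; first by case: h.
  have [_ c] := dJ i j; apply: near_eq_continuous c.
  have : \forall y \near x, H y by exact: open_nbhs_nbhs.
  apply: filterS => y Hy; symmetry.
  by case: (is_derive_partial_jet i j oH hJ Hy).
Qed.

End Jets.

(** * The Laplacian of the upper half-space *)

Section HalfSpace.
Variables (R : realType) (m : nat).
Local Notation E := 'rV[R]_m.+2.
Implicit Types (x z : E) (J K : jet R m.+2).

Definition half_space : set E := [set x | 0 < height x].

(** In dimension n = m+2 with height y: y^2 times the Euclidean Laplacian minus (n-2) y d/dy. *)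
Definition hyp_lap J x : R :=
  height x ^+ 2 * (\sum_i jhess J i i x) - m%:R * height x * jgrad J ord_max x.

Definition hyp_grad J K x : R := height x ^+ 2 * \sum_i jgrad J i x * jgrad K i x.

Lemma half_space_open : open half_space.
Proof.
have -> : half_space = (fun x : E => x 0 ord_max) @^-1` [set y | 0 < y] by [].
by apply: open_comp; [move=> x _; exact: coord_continuous|exact: open_gt].
Qed.

Lemma sqrt_det_hyp_metric z : half_space z ->
  Num.sqrt (\det (@hyp_metric R m.+1 z)) = (height z)^-1 ^+ m.+2.
Proof.
move=> z0; rewrite /hyp_metric det_scalar -exprVn -exprM mulnC exprM sqrtr_sqr.
by rewrite ger0_norm// exprn_ge0// invr_ge0 ltW.
Qed.

(** The volume density is y^(-n) and the inverse metric y^2, so that the flux is y^(-m) times the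
    Euclidean gradient. *)
Lemma laplace_beltrami_jet J x : jet_on half_space J -> half_space x ->
  laplace_beltrami (@hyp_metric R m.+1) (jval J) x = hyp_lap J x.
Proof.
move=> hJ x0; rewrite /laplace_beltrami sqrt_det_hyp_metric//.
have hn0 : height x != 0 by rewrite gt_eqF.
have hflux i : partial i (fun z => Num.sqrt (\det (@hyp_metric R m.+1 z)) *
    \sum_j invmx (@hyp_metric R m.+1 z) i j * partial j (jval J) z) x =
    - (m%:R * (height x)^-1 ^+ m.+1) * ((ord_max == i)%:R * jgrad J i x)
    + (height x)^-1 ^+ m * jhess J i i x.
  have hd : is_derive x (delta_mx 0 i) (fun z => (height z)^-1 ^+ m * jgrad J i z)
    (- (m%:R * (height x)^-1 ^+ m.+1) * ((ord_max == i)%:R * jgrad J i x)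
    + (height x)^-1 ^+ m * jhess J i i x).
    have [_ _ /(_ i i)[hg _]] := hJ x x0.
    have hh : is_derive x (delta_mx 0 i) (@height R m.+1) (ord_max == i)%:R.
      have := is_derive_coord x (delta_mx 0 i) ord_max.
      by rewrite mxE eqxx/= => h; exact: h.
    move: hh; move: ((ord_max == i)%:R : R) => b hh.
    derive => //.
    (* For m = 0 the truncated exponent [m.-1] is wrong, but its factor m is 0. *)
    have -> : m%:R * (height x)^-1 ^+ m.+1 =
        m%:R * (height x)^-1 ^+ m.-1 * (height x)^-1 ^+ 2 :> R.
      by move: (height x)^-1 => v; case: (m) => [|k]; rewrite ?mul0r// -mulrA -exprD addn2.
    by rewrite [(height x)^-1 ^+ 2]exprVn; ring.
  have : is_derive x (delta_mx 0 i) (fun z => Num.sqrt (\det (@hyp_metric R m.+1 z)) *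
    \sum_j invmx (@hyp_metric R m.+1 z) i j * partial j (jval J) z) (
    - (m%:R * (height x)^-1 ^+ m.+1) * ((ord_max == i)%:R * jgrad J i x)
    + (height x)^-1 ^+ m * jhess J i i x).
    apply: near_eq_is_derive hd.
    have : \forall z \near x, half_space z.
      by apply: open_nbhs_nbhs; split=> //; exact: half_space_open.
    apply: filterS => z z0; rewrite sqrt_det_hyp_metric//.
    rewrite /hyp_metric invmx_scalar (bigD1 i)//= big1 => [|j ji]; last first.
      by rewrite mxE eq_sym (negbTE ji) mul0r.
    rewrite addr0 mxE eqxx mulr1n (partial_jet i hJ z0).
    have zn : height z != 0 by rewrite gt_eqF.
    move: (height z) (jgrad J i z) zn => h c h0; rewrite !exprS.
    by move: (h^-1 ^+ m) => P; field.
  by case.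
under eq_bigr do rewrite hflux.
rewrite big_split/= -!mulr_sumr (bigD1 ord_max)//= big1 => [|j ji]; last first.
  by rewrite eq_sym (negbTE ji) mul0r.
rewrite eqxx mul1r addr0 /hyp_lap -exprVn invrK !exprS.
have -> : height x * (height x * height x ^+ m) = height x ^+ m * (height x * height x) by ring.
have e : height x ^+ m * (height x)^-1 ^+ m = 1 by rewrite -exprMn divff// expr1n.
transitivity (height x ^+ m * (height x)^-1 ^+ m * (height x * height x *
  (- (m%:R * (height x)^-1) * jgrad J ord_max x + \sum_i jhess J i i x))).
  ring.
by rewrite e; field.
Qed.

Lemma hyp_lap_mul J K x : hyp_lap (jet_mul J K) x =
  hyp_lap J x * jval K x + jval J x * hyp_lap K x + 2 * hyp_grad J K x.
Proof.
rewrite /hyp_lap /hyp_grad /= !big_split/= -mulr_suml -mulr_sumr.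
by ring.
Qed.

Lemma hyp_grad_mull J K L x : hyp_grad (jet_mul J K) L x =
  jval K x * hyp_grad J L x + jval J x * hyp_grad K L x.
Proof.
rewrite /hyp_grad /= [RHS]addrC.
have -> : \sum_i (jgrad J i x * jval K x + jval J x * jgrad K i x) * jgrad L i x =
  jval K x * (\sum_i jgrad J i x * jgrad L i x) +
  jval J x * (\sum_i jgrad K i x * jgrad L i x).
  by rewrite !mulr_sumr -big_split/=; apply: eq_bigr => i _; ring.
by ring.
Qed.

Lemma hyp_gradC J K x : hyp_grad J K x = hyp_grad K J x.
Proof. by rewrite /hyp_grad; under eq_bigr do rewrite mulrC. Qed.

Lemma hyp_lap_comp f f1 f2 J x : hyp_lap (jet_comp f f1 f2 J) x =
  f2 (jval J x) * hyp_grad J J x + f1 (jval J x) * hyp_lap J x.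
Proof.
rewrite /hyp_lap /hyp_grad /= big_split/= -mulr_sumr.
under eq_bigr do rewrite -mulrA.
by rewrite -mulr_sumr; ring.
Qed.

Lemma hyp_grad_comp f f1 f2 J K x :
  hyp_grad (jet_comp f f1 f2 J) K x = f1 (jval J x) * hyp_grad J K x.
Proof.
rewrite /hyp_grad /=; under eq_bigr do rewrite -mulrA.
by rewrite -mulr_sumr; ring.
Qed.

Lemma hyp_lap_add J K x : hyp_lap (jet_add J K) x = hyp_lap J x + hyp_lap K x.
Proof. by rewrite /hyp_lap /= big_split/=; ring. Qed.

Lemma hyp_grad_addl J K L x :
  hyp_grad (jet_add J K) L x = hyp_grad J L x + hyp_grad K L x.
Proof.
rewrite /hyp_grad /= -mulrDr -big_split/=; congr (_ * _).
by apply: eq_bigr => i _; rewrite mulrDl.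
Qed.

Lemma hyp_lap_const c x : hyp_lap (jet_const _ c) x = 0.
Proof. by rewrite /hyp_lap /= big1// !mulr0 subr0. Qed.

Lemma hyp_grad_constl c K x : hyp_grad (jet_const _ c) K x = 0.
Proof. by rewrite /hyp_grad /= big1 ?mulr0// => i _; rewrite mul0r. Qed.

End HalfSpace.

(** * Hyperboloid coordinates around the centre p *)

Section DistanceJet.
Variables (R : realType) (m : nat) (p : 'rV[R]_m.+2).
Hypothesis p0 : 0 < height p.
Local Notation E := 'rV[R]_m.+2.
Local Notation H := (@half_space R m).
Implicit Types (x : E) (K : jet R m.+2).

Definition jet_disp (k : 'I_m.+2) : jet R m.+2 :=
  jet_add (jet_coord R k) (jet_const _ (- p 0 k)).

Definition jet_inv_height : jet R m.+2 :=
  jet_comp (fun y => y^-1) (fun y => - y ^- 2) (fun y => 2 * y ^- 3)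
    (jet_coord R ord_max).

Definition jet_sqr_disp : jet R m.+2 :=
  jet_sum (fun k => jet_mul (jet_disp k) (jet_disp k)).

(* The function cosh d(p, x) - 1. *)
Definition jet_cosh_sub1 : jet R m.+2 :=
  jet_mul (jet_const _ (2 * height p)^-1) (jet_mul jet_sqr_disp jet_inv_height).

(* Two of the hyperboloid coordinates vanishing at p, up to scaling. *)
Definition jet_horizontal : jet R m.+2 := jet_mul (jet_disp ord0) jet_inv_height.

Definition jet_vertical : jet R m.+2 :=
  jet_add (jet_add jet_cosh_sub1 (jet_const _ 1))
    (jet_mul (jet_const _ (- height p)) jet_inv_height).

Lemma jet_on_disp k : jet_on H (jet_disp k).
Proof. by apply: jet_on_add; [exact: jet_on_coord|exact: jet_on_const]. Qed.

Lemma jet_on_inv_height : jet_on H jet_inv_height.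
Proof.
apply: jet_on_comp; first exact: jet_on_coord.
move=> x x0 /=; have xn : x 0 ord_max != 0 by rewrite gt_eqF.
split.
- by derive => //; rewrite mulN1r.
- by derive; rewrite ?expf_neq0//=; field.
- have [d hd] : exists d : R, is_derive (x 0 ord_max) 1 (fun y : R => 2 * y ^- 3) d.
    by eexists; derive; [rewrite expf_neq0|reflexivity].
  exact: derive_continuous hd.
Qed.

Lemma jet_on_cosh_sub1 : jet_on H jet_cosh_sub1.
Proof.
apply: jet_on_mul; first exact: jet_on_const.
apply: jet_on_mul; last exact: jet_on_inv_height.
by apply: jet_on_sum => k; apply: jet_on_mul; exact: jet_on_disp.
Qed.

Lemma jet_on_horizontal : jet_on H jet_horizontal.
Proof. by apply: jet_on_mul; [exact: jet_on_disp|exact: jet_on_inv_height]. Qed.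

Lemma jet_on_vertical : jet_on H jet_vertical.
Proof.
apply: jet_on_add.
  by apply: jet_on_add; [exact: jet_on_cosh_sub1|exact: jet_on_const].
by apply: jet_on_mul; [exact: jet_on_const|exact: jet_on_inv_height].
Qed.

Lemma hyp_grad_coord k K x :
  hyp_grad (jet_coord R k) K x = height x ^+ 2 * jgrad K k x.
Proof.
rewrite /hyp_grad (bigD1 k)//= big1 => [|i ik]; last first.
  by rewrite eq_sym (negbTE ik) mul0r.
by rewrite eqxx mul1r addr0.
Qed.

Lemma hyp_grad_disp k K x :
  hyp_grad (jet_disp k) K x = height x ^+ 2 * jgrad K k x.
Proof. by rewrite hyp_grad_addl hyp_grad_constl addr0 hyp_grad_coord. Qed.

Lemma hyp_lap_disp k x :
  hyp_lap (jet_disp k) x = - m%:R * height x * (k == ord_max)%:R.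
Proof.
rewrite hyp_lap_add hyp_lap_const addr0 /hyp_lap /= big1//.
by rewrite mulr0 sub0r !mulNr.
Qed.

Lemma hyp_grad_inv_height K x : H x ->
  hyp_grad jet_inv_height K x = - jgrad K ord_max x.
Proof.
move=> x0; have hn : height x != 0 by rewrite gt_eqF.
rewrite hyp_grad_comp hyp_grad_coord /= -/(height x).
by rewrite mulrA mulNr mulVf ?mulN1r// expf_neq0.
Qed.

Lemma hyp_lap_inv_height x : H x -> hyp_lap jet_inv_height x = m.+2%:R / height x.
Proof.
move=> x0; have hn : height x != 0 by rewrite gt_eqF.
rewrite hyp_lap_comp hyp_grad_coord.
have -> : hyp_lap (jet_coord R ord_max) x = - (m%:R * height x).
  by rewrite /hyp_lap /= big1// eqxx mulr1 mulr0 sub0r.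
rewrite /= eqxx mulr1 -/(height x).
have -> : m.+2%:R = m%:R + 2 :> R by rewrite -addn2 natrD.
by move: (height x) hn => h hn; field.
Qed.

Lemma jgrad_sqr_disp i x : jgrad jet_sqr_disp i x = 2 * (x 0 i - p 0 i).
Proof.
rewrite /= (bigD1 i)//= big1 => [|k ki].
  by rewrite eqxx /=; ring.
by rewrite (negbTE ki) /=; ring.
Qed.

Lemma hyp_grad_sqr_disp K x : hyp_grad jet_sqr_disp K x =
  2 * height x ^+ 2 * \sum_i (x 0 i - p 0 i) * jgrad K i x.
Proof.
rewrite /hyp_grad; under eq_bigr do rewrite jgrad_sqr_disp -mulrA.
by rewrite -mulr_sumr; ring.
Qed.

Lemma jval_sqr_disp x : jval jet_sqr_disp x = \sum_i (x 0 i - p 0 i) ^+ 2.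
Proof. by rewrite /=; apply: eq_bigr => i _; rewrite expr2. Qed.

Lemma hyp_lap_sqr_disp x : hyp_lap jet_sqr_disp x =
  2 * m.+2%:R * height x ^+ 2 - 2 * m%:R * height x * (height x - height p).
Proof.
rewrite /hyp_lap jgrad_sqr_disp.
have -> : \sum_i jhess jet_sqr_disp i i x = 2 * m.+2%:R.
  rewrite (eq_bigr (fun=> 2)) => [|i _].
    by rewrite sumr_const card_ord mulr_natr.
  rewrite /= (bigD1 i)//= big1 => [|k ki].
    by rewrite eqxx /=; ring.
  by rewrite (negbTE ki) /=; ring.
by rewrite /height; ring.
Qed.

Lemma jval_cosh_sub1 x : jval jet_cosh_sub1 x =
  (\sum_i (x 0 i - p 0 i) ^+ 2) / (2 * height x * height p).
Proof.
rewrite -jval_sqr_disp [LHS]/= -/(height x) -[\sum_i _]/(jval jet_sqr_disp x).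
by rewrite mulrCA -invfM; congr (_ / _); ring.
Qed.

Lemma jgrad_cosh_sub1 i x : jgrad jet_cosh_sub1 i x = (2 * height p)^-1 *
    (2 * (x 0 i - p 0 i) / height x - jval jet_sqr_disp x * (ord_max == i)%:R / height x ^+ 2).
Proof.
transitivity (0 * jval (jet_mul jet_sqr_disp jet_inv_height) x + (2 * height p)^-1 *
  (jgrad jet_sqr_disp i x * (height x)^-1 +
   jval jet_sqr_disp x * (- height x ^- 2 * (ord_max == i)%:R))); first by [].
by rewrite jgrad_sqr_disp; ring.
Qed.

Lemma hyp_grad_cosh_sub1 K x : H x -> hyp_grad jet_cosh_sub1 K x =
  (2 * height p)^-1 * ((height x)^-1 * hyp_grad jet_sqr_disp K x
    - jval jet_sqr_disp x * jgrad K ord_max x).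
Proof.
move=> x0; rewrite /jet_cosh_sub1 hyp_grad_mull hyp_grad_constl mulr0 add0r.
by rewrite hyp_grad_mull hyp_grad_inv_height// mulrN.
Qed.

(** X + 1 = cosh d is a linear function on the hyperboloid, which the Laplacian multiplies by n. *)
Lemma hyp_lap_cosh_sub1 x : H x ->
  hyp_lap jet_cosh_sub1 x = m.+2%:R * (jval jet_cosh_sub1 x + 1).
Proof.
move=> x0; have hn : height x != 0 by rewrite gt_eqF.
have pn : height p != 0 by rewrite gt_eqF.
rewrite {1}/jet_cosh_sub1 hyp_lap_mul hyp_lap_const mul0r add0r hyp_grad_constl.
rewrite mulr0 addr0 hyp_lap_mul hyp_lap_inv_height// hyp_lap_sqr_disp.
rewrite [hyp_grad _ _ _]hyp_gradC hyp_grad_inv_height// jgrad_sqr_disp.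
rewrite jval_cosh_sub1 -jval_sqr_disp -[x 0 ord_max]/(height x) -[p 0 ord_max]/(height p).
have -> : jval jet_inv_height x = (height x)^-1 by [].
have -> : jval (jet_const m.+2 (2 * height p)^-1) x = (2 * height p)^-1 by [].
have -> : m.+2%:R = m%:R + 2 :> R by rewrite -addn2 natrD.
move: (jval _ _) (height x) (height p) hn pn => q h k hn kn.
by field; rewrite hn kn.
Qed.

(** The squared gradient of cosh d is sinh^2 d. *)
Lemma hyp_grad_cosh_sub1_self x : H x -> hyp_grad jet_cosh_sub1 jet_cosh_sub1 x =
  jval jet_cosh_sub1 x ^+ 2 + 2 * jval jet_cosh_sub1 x.
Proof.
move=> x0; have hn : height x != 0 by rewrite gt_eqF.
have pn : height p != 0 by rewrite gt_eqF.
have gX i := jgrad_cosh_sub1 i x.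
rewrite hyp_grad_cosh_sub1// hyp_grad_sqr_disp.
have -> : \sum_i (x 0 i - p 0 i) * jgrad jet_cosh_sub1 i x =
   (2 * height p)^-1 * (2 * jval jet_sqr_disp x / height x -
     jval jet_sqr_disp x * (height x - height p) / height x ^+ 2).
  transitivity ((2 * height p)^-1 * (2 / height x * (\sum_i (x 0 i - p 0 i) ^+ 2) -
    jval jet_sqr_disp x / height x ^+ 2 * \sum_i (x 0 i - p 0 i) * (ord_max == i)%:R)).
    rewrite !mulr_sumr -sumrB mulr_sumr; apply: eq_bigr => i _.
    by rewrite gX; ring.
  rewrite -jval_sqr_disp.
  have -> : \sum_i (x 0 i - p 0 i) * (ord_max == i)%:R = height x - height p.
    rewrite (bigD1 ord_max)//= big1 => [|i im]; last by rewrite eq_sym (negbTE im) mulr0.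
    by rewrite eqxx mulr1 addr0.
  by ring.
rewrite gX eqxx jval_cosh_sub1 -jval_sqr_disp -/(height x) -/(height p) mulr1.
move: (jval _ _) (height x) (height p) hn pn => q h k hn kn.
by field; rewrite hn kn.
Qed.

Lemma hyp_grad_cosh_sub1_inv_height x : H x ->
  hyp_grad jet_cosh_sub1 jet_inv_height x =
  jval jet_cosh_sub1 x / height x - (height x - height p) / (height x * height p).
Proof.
move=> x0; have hn : height x != 0 by rewrite gt_eqF.
have pn : height p != 0 by rewrite gt_eqF.
rewrite hyp_grad_cosh_sub1// hyp_gradC hyp_grad_inv_height// jgrad_sqr_disp.
rewrite jval_cosh_sub1 -jval_sqr_disp -/(height x) -/(height p).
have -> : jgrad jet_inv_height ord_max x = - height x ^- 2.
  by rewrite /= eqxx mulr1.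
move: (jval _ _) (height x) (height p) hn pn => q h k hn kn.
by field; rewrite hn kn.
Qed.

Lemma hyp_lap_vertical x : H x ->
  hyp_lap jet_vertical x = m.+2%:R * jval jet_vertical x.
Proof.
move=> x0; rewrite /jet_vertical hyp_lap_add hyp_lap_add hyp_lap_cosh_sub1//.
rewrite hyp_lap_const addr0 hyp_lap_mul hyp_lap_const hyp_grad_constl.
rewrite hyp_lap_inv_height// mul0r add0r mulr0 addr0.
have -> : jval (jet_add (jet_add jet_cosh_sub1 (jet_const m.+2 1))
  (jet_mul (jet_const m.+2 (- height p)) jet_inv_height)) x =
  jval jet_cosh_sub1 x + 1 - height p / height x by rewrite -mulNr.
have -> : jval (jet_const m.+2 (- height p)) x = - height p by [].
by ring.
Qed.

(** The gradients of two linear functions on the hyperboloid have as inner product the product of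
    the functions plus the Minkowski product of their vectors; the latter is 0 here because the
    coordinate vanishes at p. *)
Lemma hyp_grad_vertical x : H x -> hyp_grad jet_vertical jet_cosh_sub1 x =
  (jval jet_cosh_sub1 x + 1) * jval jet_vertical x.
Proof.
move=> x0; have hn : height x != 0 by rewrite gt_eqF.
have pn : height p != 0 by rewrite gt_eqF.
rewrite /jet_vertical !hyp_grad_addl hyp_grad_cosh_sub1_self// hyp_grad_constl addr0.
rewrite hyp_grad_mull hyp_grad_constl mulr0 add0r hyp_gradC.
rewrite hyp_grad_cosh_sub1_inv_height//.
have -> : jval (jet_add (jet_add jet_cosh_sub1 (jet_const m.+2 1))
  (jet_mul (jet_const m.+2 (- height p)) jet_inv_height)) x =
  jval jet_cosh_sub1 x + 1 - height p / height x by rewrite -mulNr.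
have -> : jval (jet_const m.+2 (- height p)) x = - height p by [].
move: (jval _ _) (height x) (height p) hn pn => q h k hn kn.
by field; rewrite hn kn.
Qed.

Lemma hyp_lap_horizontal x : H x ->
  hyp_lap jet_horizontal x = m.+2%:R * jval jet_horizontal x.
Proof.
move=> x0; rewrite /jet_horizontal hyp_lap_mul hyp_lap_disp hyp_lap_inv_height//.
rewrite hyp_gradC hyp_grad_inv_height//.
have -> : jgrad (jet_disp ord0) ord_max x = 0 by rewrite /= addr0.
have -> : (ord0 == ord_max :> 'I_m.+2) = false by [].
have -> : jval (jet_mul (jet_disp ord0) jet_inv_height) x =
  jval (jet_disp ord0) x / height x by [].
by rewrite /=; ring.
Qed.

Lemma hyp_grad_horizontal x : H x -> hyp_grad jet_horizontal jet_cosh_sub1 x =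
  (jval jet_cosh_sub1 x + 1) * jval jet_horizontal x.
Proof.
move=> x0; have hn : height x != 0 by rewrite gt_eqF.
have pn : height p != 0 by rewrite gt_eqF.
rewrite /jet_horizontal hyp_grad_mull hyp_grad_disp [hyp_grad jet_inv_height _ _]hyp_gradC.
rewrite hyp_grad_cosh_sub1_inv_height//.
have -> : jgrad jet_cosh_sub1 ord0 x = (x 0 ord0 - p 0 ord0) / (height x * height p).
  rewrite jgrad_cosh_sub1 /= mulr0 mul0r subr0; move: (height x) (height p) hn pn => h k hn kn.
  by field; rewrite hn kn.
have -> : jval (jet_mul (jet_disp ord0) jet_inv_height) x =
  jval (jet_disp ord0) x / height x by [].
have -> : jval jet_inv_height x = (height x)^-1 by [].
have -> : jval (jet_disp ord0) x = x 0 ord0 - p 0 ord0 by [].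
move: (jval _ _) (height x) (height p) hn pn (x 0 ord0 - _) => q h k hn kn a.
by field; rewrite hn kn.
Qed.

End DistanceJet.

(** * Eigenfunctions on geodesic balls *)

Lemma acosh_lt (R : realType) (X r : R) : 0 <= X -> 0 < r ->
  (acosh (1 + X) < r) = (X < cosh r - 1).
Proof.
move=> X0 r0; rewrite /acosh.
have y1 : 1 <= 1 + X by rewrite lerDl.
have e : expR r = cosh r + sinh r by rewrite /cosh /sinh; field.
have arg0 : 0 < 1 + X + Num.sqrt ((1 + X) ^+ 2 - 1).
  by rewrite (lt_le_trans ltr01)// (le_trans y1)// lerDl sqrtr_ge0.
have -> : (ln (1 + X + Num.sqrt ((1 + X) ^+ 2 - 1)) < r) =
    (1 + X + Num.sqrt ((1 + X) ^+ 2 - 1) < expR r).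
  by rewrite -[in RHS](lnK arg0) ltr_expR.
have sh : sinh r = Num.sqrt (cosh r ^+ 2 - 1).
  by rewrite cosh2_sinh2 addrK sqrtr_sqr ger0_norm// sinh_ge0// ltW.
have c0 := cosh_gt0 r.
rewrite e sh ltrBrDl; have [lt|ge] := ltP (1 + X) (cosh r).
  apply: ltr_leD => //; apply: ler_wsqrtr; rewrite lerD2r.
  by rewrite ler_pXn2r ?nnegrE ?(ltW lt)//; lra.
apply/negbTE; rewrite -leNgt lerD//; apply: ler_wsqrtr; rewrite lerD2r.
by rewrite ler_pXn2r ?nnegrE//; lra.
Qed.

Section Ball.
Variables (R : realType) (m : nat) (p : 'rV[R]_m.+2) (r : R).
Hypotheses (p0 : 0 < height p) (r0 : 0 < r).
Local Notation n := (m.+2%:R : R).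
Local Notation H := (@half_space R m).
Local Notation Omega := (geodesic_ball p r).
Local Notation M := (cosh r - 1).
Local Notation X := (jval (jet_cosh_sub1 p)).
Implicit Types (x : 'rV[R]_m.+2) (Y : jet R m.+2) (nu lam : R).

Lemma cosh_sub1_ge0 x : H x -> 0 <= X x.
Proof.
move=> x0; rewrite jval_cosh_sub1 divr_ge0//.
  by apply: sumr_ge0 => i _; exact: sqr_ge0.
by rewrite !mulr_ge0// ltW.
Qed.

Lemma geodesic_ballE x : Omega x <-> H x /\ X x < M.
Proof.
rewrite /geodesic_ball /= /half_space /=.
have e : (1 + (\sum_(i < m.+2) (p 0 i - x 0 i) ^+ 2) / (2 * height p * height x)) =
    1 + X x.
  rewrite jval_cosh_sub1; congr (_ + _ / _); last by ring.
  by apply: eq_bigr => i _; rewrite -[RHS]sqrrN opprB.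
by split=> -[x0 xr]; split=> //; move: xr; rewrite /hyp_dist e acosh_lt// cosh_sub1_ge0.
Qed.

Lemma geodesic_ball_half_space x : Omega x -> H x.
Proof. by case. Qed.

(** Clearing the denominator in X <= M gives a polynomial inequality, closed in the whole coordinate
    space. At height 0 it would force the squared displacement, at least (height p)^2, to be <= 0,
    so that the closed ball stays in the half-space. *)
Lemma closure_geodesic_ball x : closure Omega x -> H x /\ X x <= M.
Proof.
have M0 : 0 < M by exact: cosh_sub1_gt0.
pose q : jet R m.+2 := jet_add
  (jet_mul (jet_const _ (2 * M * height p)) (jet_coord R ord_max))
  (jet_mul (jet_const _ (-1)) (jet_sqr_disp p)).
have cq : continuous (jval q).
  have hq : jet_on setT q.
    apply: jet_on_add.
      by apply: jet_on_mul; [exact: jet_on_const|exact: jet_on_coord].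
    apply: jet_on_mul; first exact: jet_on_const.
    apply: jet_on_sum => k.
    by apply: jet_on_mul; apply: jet_on_add;
      [exact: jet_on_coord|exact: jet_on_const|exact: jet_on_coord|exact: jet_on_const].
  by move=> y; have [] := hq y I.
have qE y : jval q y = 2 * M * height p * height y - \sum_i (y 0 i - p 0 i) ^+ 2.
  by rewrite -jval_sqr_disp -[- jval _ _]mulN1r.
clearbody q.
have cC : closed [set y | 0 <= jval q y].
  have -> : [set y | 0 <= jval q y] = jval q @^-1` [set z | 0 <= z] by [].
  by apply: closed_comp => [y _|]; [exact: cq|exact: closed_ge].
have sub : Omega `<=` [set y | 0 <= jval q y].
  move=> y /geodesic_ballE[y0 yM] /=; rewrite qE subr_ge0.
  move: yM; rewrite jval_cosh_sub1 ltr_pdivrMr ?mulr_gt0// => /ltW h.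
  by apply: le_trans h _; rewrite le_eqVlt; apply/orP; left; apply/eqP; ring.
move=> /(closure_subset sub); rewrite -(closure_id _).1// => qx.
have h : \sum_i (x 0 i - p 0 i) ^+ 2 <= 2 * M * height p * height x.
  by rewrite -subr_ge0 -qE.
have S0 : 0 <= \sum_i (x 0 i - p 0 i) ^+ 2.
  by apply: sumr_ge0 => i _; exact: sqr_ge0.
have c0 : 0 < 2 * M * height p by rewrite !mulr_gt0.
have x0 : 0 < height x.
  have : 0 <= height x by rewrite -(pmulr_rge0 _ c0) (le_trans S0).
  rewrite le_eqVlt => /orP[/eqP e|//].
  have : (height x - height p) ^+ 2 <= \sum_i (x 0 i - p 0 i) ^+ 2.
    by rewrite (bigD1 ord_max)//= lerDl; apply: sumr_ge0 => i _; exact: sqr_ge0.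
  rewrite -e mulr0 in h * => h1.
  have := le_trans h1 h; rewrite sub0r sqrrN leNgt exprn_gt0//.
split=> //; rewrite jval_cosh_sub1 ler_pdivrMr ?mulr_gt0//.
by apply: le_trans h _; rewrite le_eqVlt; apply/orP; left; apply/eqP; ring.
Qed.

Definition jet_radial nu lam : jet R m.+2 :=
  jet_comp (radial nu lam) (radial1 nu lam) (radial2 nu lam) (jet_cosh_sub1 p).

Lemma jet_on_radial nu lam : 1 <= nu -> jet_on H (jet_radial nu lam).
Proof.
move=> nu1; apply: jet_on_comp; first exact: jet_on_cosh_sub1.
move=> x x0; have X1 : -1 < X x by have := cosh_sub1_ge0 x0; lra.
split; [exact: is_derive_radial|exact: is_derive_radial1|].
have h : derivable (radial2 nu lam) (X x) 1 by exact: derivable_radial2.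
exact/differentiable_continuous/derivable1_diffP.
Qed.

Lemma dirichlet_eigenspace_jet Y lam : jet_on H Y ->
  (forall x, H x -> X x = M -> jval Y x = 0) ->
  (forall x, H x -> - hyp_lap Y x = lam * jval Y x) ->
  dirichlet_eigenspace (@hyp_metric R m.+1) Omega lam (jval Y).
Proof.
move=> hY YM hlap; split.
- apply: continuous_in_subspaceT => x; rewrite inE => /closure_geodesic_ball[x0 _].
  by have [] := hY x x0.
- by move=> x /geodesic_ball_half_space x0; exact: (jet_C2_on (@half_space_open R m) hY).
- move=> x [/closure_geodesic_ball[x0 xM] nx]; apply: YM => //.
  apply/eqP; rewrite eq_le xM leNgt; apply/negP => h; apply: nx.
  exact/geodesic_ballE.
- move=> x /geodesic_ball_half_space x0; rewrite laplace_beltrami_jet//.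
  exact: hlap.
Qed.

Lemma dirichlet_eigenspace_radial lam : radial (n / 2) lam M = 0 ->
  dirichlet_eigenspace (@hyp_metric R m.+1) Omega lam (jval (jet_radial (n / 2) lam)).
Proof.
move=> zM; have n2 : 1 <= n / 2 by rewrite ler_pdivlMr// mul1r ler_nat.
apply: dirichlet_eigenspace_jet; first exact: jet_on_radial.
  by move=> x _ /= ->.
move=> x x0; rewrite hyp_lap_comp hyp_grad_cosh_sub1_self// hyp_lap_cosh_sub1//.
have X1 : -1 < X x by have := cosh_sub1_ge0 x0; lra.
have -> : jval (jet_radial (n / 2) lam) x = radial (n / 2) lam (X x) by [].
have := radial_ode n2 lam X1.
by move: (X x) (radial2 _ _ _) (radial1 _ _ _) (radial _ _ _) => y f2 f1 f; lra.
Qed.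

(** The cross term 2 (X+1) F' Y of the product rule raises the dimension in the radial equation from
    n to n + 2, and the Laplacian of Y lowers the eigenvalue by n. *)
Lemma dirichlet_eigenspace_linear Y lam : jet_on H Y ->
  (forall x, H x -> hyp_lap Y x = n * jval Y x) ->
  (forall x, H x -> hyp_grad Y (jet_cosh_sub1 p) x = (X x + 1) * jval Y x) ->
  radial (n / 2 + 1) lam M = 0 ->
  dirichlet_eigenspace (@hyp_metric R m.+1) Omega (lam - n)
    (jval (jet_mul Y (jet_radial (n / 2 + 1) lam))).
Proof.
move=> hY lapY gradY zM.
have n2 : 1 <= n / 2 + 1 by rewrite lerDr divr_ge0.
apply: dirichlet_eigenspace_jet.
- by apply: jet_on_mul => //; exact: jet_on_radial.
- by move=> x _ /= ->; rewrite zM mulr0.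
move=> x x0; rewrite hyp_lap_mul lapY// hyp_lap_comp hyp_grad_cosh_sub1_self//.
rewrite hyp_lap_cosh_sub1// hyp_gradC hyp_grad_comp hyp_gradC gradY//.
have X1 : -1 < X x by have := cosh_sub1_ge0 x0; lra.
have o := radial_ode n2 lam X1.
have -> : jval (jet_mul Y (jet_radial (n / 2 + 1) lam)) x =
  jval Y x * radial (n / 2 + 1) lam (X x) by [].
have -> : jval (jet_radial (n / 2 + 1) lam) x = radial (n / 2 + 1) lam (X x) by [].
move: o; move: n (jval Y x) (X x) (radial2 _ _ _) (radial1 _ _ _) (radial _ _ _).
move=> k Yx y f2 f1 f o.
apply/eqP; rewrite -subr_eq0; apply/eqP.
transitivity (- Yx * ((y ^+ 2 + 2 * y) * f2 + 2 * (k / 2 + 1) * (y + 1) * f1 + lam * f)).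
  by field.
by rewrite o mulr0.
Qed.

End Ball.

(** * From eigenfunctions to bounds on the eigenvalues *)

Lemma bound_by_radial_eigenvalue (R : realType) (s r l K : R) :
  1 <= s -> 0 < r ->
  (forall lam, radial (s + 2^-1) lam (cosh r - 1) = 0 ->
     (forall X, 0 <= X < cosh r - 1 -> 0 < radial (s + 2^-1) lam X) ->
     l <= K + lam) ->
  let B := K + s ^+ 2 + ((pi / r) ^+ 2 + s * (s - 1) * pi ^+ 4 / (3 * r ^+ 3)) in
  l <= B /\ (1 < s -> l < B).
Proof.
move=> s1 r0 hl; set C := (pi / r) ^+ 2 + _ => B; split.
  apply/ler_addgt0Pr => e e0.
  have [||lam lamC [zM pos]] := radial_eigenvalue (B := C + e) s1 r0.
  - by rewrite lerDl ltW.
  - by left; rewrite ltrDl.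
  by apply: le_trans (hl lam zM pos) _; rewrite /B; lra.
move=> ss1; have [||lam lamC [zM pos]] := radial_eigenvalue (B := C) s1 r0.
- exact: lexx.
- by right.
by apply: le_lt_trans (hl lam zM pos) _; rewrite /B; lra.
Qed.

Section Spectrum.
Variables (R : realType) (d : nat) (g : 'rV[R]_d -> 'M[R]_d) (Omega : set 'rV[R]_d).
Variable lam : nat -> R.
Hypothesis hlam : dirichlet_spectrum g Omega lam.

Lemma dirichlet_spectrum_first mu (u : 'rV[R]_d -> R) x :
  dirichlet_eigenspace g Omega mu u -> Omega x -> u x != 0 -> lam 0%N <= mu.
Proof.
move=> hu Ox ux; have [nd spec] := hlam.
have [] := (spec mu 1%N).1 _; last first.
  move=> [|i [|? ?]] [] // _ _ h; have <- : lam i = mu by apply: h; rewrite inE.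
  exact: nd.
exists (fun=> u); split=> // c /(_ x Ox); rewrite big_ord1 => /eqP.
by rewrite mulf_eq0 (negbTE ux) orbF => /eqP c0 i; rewrite (ord1 i).
Qed.

(** Evaluation at x and y is triangular, which makes u, v free; two distinct indices then carry the
    value mu, and one of them is at least 1. *)
Lemma dirichlet_spectrum_second mu (u v : 'rV[R]_d -> R) x y :
  dirichlet_eigenspace g Omega mu u -> dirichlet_eigenspace g Omega mu v ->
  Omega x -> Omega y -> u x = 0 -> v x != 0 -> u y != 0 -> lam 1%N <= mu.
Proof.
move=> hu hv Ox Oy ux vx uy; have [nd spec] := hlam.
have [] := (spec mu 2%N).1 _; last first.
  move=> [|i [|j [|? ?]]] [] //= /andP[]; rewrite inE => ij _ _ h.
  have li : lam i = mu by apply: h; rewrite inE eqxx.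
  have lj : lam j = mu by apply: h; rewrite !inE eqxx orbT.
  case: i j ij li lj {h} => [|i] [|j]// _ li lj.
  - by rewrite -lj; exact: nd.
  - by rewrite -li; exact: nd.
  - by rewrite -li; exact: nd.
exists (fun i : 'I_2 => if i == ord0 then u else v); split.
  by move=> i; case: ifP.
move=> c hc; have := hc x Ox; have := hc y Oy.
rewrite !big_ord_recl !big_ord0/= ux mulr0 add0r !addr0 => hy /eqP.
rewrite mulf_eq0 (negbTE vx) orbF => /eqP c1.
move: hy; rewrite c1 mul0r addr0 => /eqP.
rewrite mulf_eq0 (negbTE uy) orbF => /eqP c0 i.
by case: (unliftP ord0 i) => [j|] ->//; rewrite (ord1 j).
Qed.

End Spectrum.

Section BallBounds.
Variables (R : realType) (m : nat) (p : 'rV[R]_m.+2) (r : R) (lam : nat -> R).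
Hypotheses (p0 : 0 < height p) (r0 : 0 < r).
Local Notation n := (m.+2%:R : R).
Local Notation M := (cosh r - 1).
Local Notation X := (jval (jet_cosh_sub1 p)).
Hypothesis hlam :
  dirichlet_spectrum (@hyp_metric R m.+1) (geodesic_ball p r) lam.

Lemma jval_cosh_sub1_shift (i : 'I_m.+2) (h : R) :
  X (p + h *: delta_mx 0 i) =
  h ^+ 2 / (2 * (height p + h * (ord_max == i)%:R) * height p).
Proof.
rewrite jval_cosh_sub1; congr (_ / (_ * _ * _)).
  rewrite (bigD1 i)//= big1 => [|j ji]; rewrite !mxE ?eqxx /=.
    by ring.
  by rewrite (negbTE ji) /=; ring.
by rewrite /height !mxE eqxx.
Qed.

Lemma geodesic_ball_center : geodesic_ball p r p.
Proof.
apply/(geodesic_ballE p0 r0); split=> //.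
have := jval_cosh_sub1_shift ord0 0; rewrite scale0r addr0 expr0n mul0r => ->.
exact: cosh_sub1_gt0.
Qed.

Lemma first_ball_eigenvalue_le l : radial (n / 2) l M = 0 -> lam 0%N <= l.
Proof.
move=> zM; apply: (dirichlet_spectrum_first hlam
  (dirichlet_eigenspace_radial p0 r0 zM) geodesic_ball_center).
have -> : jval (jet_radial p (n / 2) l) p = radial (n / 2) l (X p) by [].
have := jval_cosh_sub1_shift ord0 0; rewrite scale0r addr0 expr0n mul0r => ->.
by rewrite radial_at0 oner_neq0.
Qed.

Lemma second_ball_eigenvalue_le l : radial (n / 2 + 1) l M = 0 ->
  (forall Z, 0 <= Z < M -> 0 < radial (n / 2 + 1) l Z) -> lam 1%N <= l - n.
Proof.
move=> zM pos; have M0 : 0 < M by exact: cosh_sub1_gt0.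
have pn : height p != 0 by rewrite gt_eqF.
pose a : R := Num.sqrt M; have a0 : 0 < a by rewrite sqrtr_gt0.
have aM : a ^+ 2 = M by rewrite sqr_sqrtr// ltW.
clearbody a.
(* This displacement with a^2 = M gives X = M/(2(1+a)) upwards and X = M/2 sideways, both inside the
   ball. *)
pose h := height p * a.
pose x := p + h *: delta_mx 0 ord_max; pose y := p + h *: delta_mx 0 (ord0 : 'I_m.+2).
have hx : height x = height p * (1 + a).
  by rewrite /height !mxE !eqxx /= -/(height p) /h; ring.
have hy : height y = height p.
  by rewrite /height !mxE eqxx /= -/(height p); ring.
have a1 : 1 + a != 0 by rewrite gt_eqF// ltr_pwDl// ltW.
have Xx : X x = M / (2 * (1 + a)).
  rewrite jval_cosh_sub1_shift eqxx /h -aM /=.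
  have -> : height p + height p * a * 1 = height p * (1 + a) by ring.
  by move: (height p) (1 + a) pn a1 => b c b0 c0; field; rewrite b0 c0.
have Xy : X y = M / 2.
  rewrite jval_cosh_sub1_shift /h -aM /=.
  by move: (height p) pn => b b0; field.
have Xxin : 0 <= X x < M.
  rewrite Xx divr_ge0 ?(ltW M0)//= ?mulr_ge0//; last lra.
  by rewrite ltr_pdivrMr; [nra|lra].
have Xyin : 0 <= X y < M by rewrite Xy; lra.
have Ox : geodesic_ball p r x.
  apply/(geodesic_ballE p0 r0); split; last by case/andP: Xxin.
  by rewrite /half_space /= hx mulr_gt0//; lra.
have Oy : geodesic_ball p r y.
  apply/(geodesic_ballE p0 r0); split; last by case/andP: Xyin.
  by rewrite /half_space /= hy.
have eu := dirichlet_eigenspace_linear p0 r0 (jet_on_horizontal p)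
  (hyp_lap_horizontal p) (hyp_grad_horizontal p0) zM.
have ev := dirichlet_eigenspace_linear p0 r0 (jet_on_vertical p)
  (hyp_lap_vertical p0) (hyp_grad_vertical p0) zM.
apply: (dirichlet_spectrum_second hlam eu ev Ox Oy).
- have -> : jval (jet_mul (jet_horizontal p) (jet_radial p (n / 2 + 1) l)) x =
    (x 0 ord0 - p 0 ord0) / height x * radial (n / 2 + 1) l (X x) by [].
  by rewrite !mxE /= mulr0 addr0 subrr !mul0r.
- have -> : jval (jet_mul (jet_vertical p) (jet_radial p (n / 2 + 1) l)) x =
    (X x + 1 + - height p / height x) * radial (n / 2 + 1) l (X x) by [].
  rewrite mulf_neq0// gt_eqF ?pos// hx.
  have -> : - height p / (height p * (1 + a)) = - (1 + a)^-1.
    by move: (height p) (1 + a) pn a1 => b c b0 c0; field; rewrite b0 c0.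
  have : (1 + a)^-1 < 1 by rewrite invf_lt1; lra.
  by case/andP: Xxin; lra.
- have -> : jval (jet_mul (jet_horizontal p) (jet_radial p (n / 2 + 1) l)) y =
    (y 0 ord0 - p 0 ord0) / height y * radial (n / 2 + 1) l (X y) by [].
  rewrite mulf_neq0//; last by rewrite gt_eqF// pos.
  rewrite hy mulf_neq0 ?invr_neq0// !mxE !eqxx /=.
  rewrite addrAC subrr add0r mulr1 gt_eqF// mulr_gt0//.
Qed.

End BallBounds.

Theorem proposition3p1 (R : realType) (m : nat) (r : R) (n := m.+2) :
  0 < r ->
  (forall alpha lambda : R,
    0 <= alpha -> first_interval_eigenvalue n r alpha lambda ->
    let B := (n%:R - 1) ^+ 2 / 4 + pi ^+ 2 / r ^+ 2
             + (n%:R - 1) * alpha / (12 * r ^+ 3) * pi ^+ 4 in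
    lambda <= B /\ (0 < alpha -> lambda < B)) /\
  (forall (p : 'rV[R]_n) (lam : nat -> R),
    0 < height p ->
    dirichlet_spectrum (@hyp_metric R m.+1) (geodesic_ball p r) lam ->
    ((3 <= n)%N ->
      let B := (n%:R - 1) ^+ 2 / 4 + pi ^+ 2 / r ^+ 2
               + (n%:R - 1) * (n%:R - 3) / (12 * r ^+ 3) * pi ^+ 4 in
      lam 0%N <= B /\ ((3 < n)%N -> lam 0%N < B)) /\
    lam 1%N < (n%:R - 1) ^+ 2 / 4 + pi ^+ 2 / r ^+ 2
              + (n%:R - 1) * (n%:R + 1) / (12 * r ^+ 3) * pi ^+ 4).
Proof.
move=> r0; have rn : r != 0 by rewrite gt_eqF.
have n1 : 1 <= n%:R - 1 :> R by rewrite lerBrDr -(natrD _ 1 1) ler_nat.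
split.
- move=> alpha lambda a0 [_ min] B.
  (* s = (1+t)/2 is the larger root of s(s-1) = (n-1) alpha/4. *)
  pose t := Num.sqrt (1 + (n%:R - 1) * alpha).
  have na : 0 <= (n%:R - 1) * alpha by rewrite mulr_ge0//; lra.
  have t2 : t ^+ 2 = 1 + (n%:R - 1) * alpha by rewrite sqr_sqrtr//; lra.
  have t0 : 0 <= t by exact: sqrtr_ge0.
  have t1 : 1 <= t by rewrite -(@ler_pXn2r _ 2)// ?nnegrE// t2 expr1n lerDl.
  clearbody t; pose s := (1 + t) / 2.
  have s1 : 1 <= s by rewrite /s; lra.
  have hs : s * (s - 1) = (n%:R - 1) * alpha / 4.
    transitivity ((t ^+ 2 - 1) / 4); first by rewrite /s; field.
    by rewrite t2; field.
  have [|hle hlt] := @bound_by_radial_eigenvalue R s r lambda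
    ((n%:R - 1) ^+ 2 / 4 - s ^+ 2) s1 r0.
    move=> l zl pos; have := min _ (interval_eigenvalue_polar s1 r0 hs zl pos).
    by move=> h; apply: le_trans h _; rewrite le_eqVlt; apply/orP; left; apply/eqP; ring.
  have eB : (n%:R - 1) ^+ 2 / 4 - s ^+ 2 + s ^+ 2 +
      ((pi / r) ^+ 2 + s * (s - 1) * pi ^+ 4 / (3 * r ^+ 3)) = B.
    rewrite hs /B; move: (pi : R) (n%:R : R) => P N; field; exact: rn.
  rewrite eB in hle hlt; split=> // a1; apply: hlt.
  have : 0 < (n%:R - 1) * alpha by rewrite mulr_gt0//; lra.
  by rewrite /s; nra.
- move=> p lam p0 hlam; split.
    move=> n3 B; pose s : R := (n%:R - 1) / 2.
    have s1 : 1 <= s.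
      by have : 3 <= n%:R :> R; [rewrite ler_nat|rewrite /s; lra].
    have hs : s + 2^-1 = n%:R / 2 by rewrite /s; field.
    have [|hle hlt] := @bound_by_radial_eigenvalue R s r (lam 0%N) 0 s1 r0.
      by move=> l; rewrite hs add0r => zl _; exact: (first_ball_eigenvalue_le p0 r0 hlam zl).
    have eB : 0 + s ^+ 2 + ((pi / r) ^+ 2 + s * (s - 1) * pi ^+ 4 / (3 * r ^+ 3)) = B.
      by rewrite /B /s; move: (pi : R) (n%:R : R) => P N; field; exact: rn.
    rewrite eB in hle hlt; split=> // n4; apply: hlt.
    by have : 4 <= n%:R :> R; [rewrite ler_nat|rewrite /s; lra].
  (* Here s(s-1) = (n-1)(n+1)/4, and the shift by -n restores s^2 - n = (n-1)^2/4. *)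
  pose s : R := (n%:R + 1) / 2.
  have ss1 : 1 < s by rewrite /s; lra.
  have hs : s + 2^-1 = n%:R / 2 + 1 by rewrite /s; field.
  have [|_ hlt] := @bound_by_radial_eigenvalue R s r (lam 1%N) (- n%:R) (ltW ss1) r0.
    move=> l; rewrite hs [- _ + _]addrC => zl pos.
    exact: (second_ball_eigenvalue_le p0 r0 hlam zl pos).
  have := hlt ss1; congr (_ < _).
  by rewrite /s; move: (pi : R) (n%:R : R) => P N; field; exact: rn.
Qed.
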